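(* Suppose $f:\mathbb{R}^d\to\mathbb{R}$ is continuously differentiable with $L$-Lipschitz continuous gradient, and let $f^*=\min_{x\in\mathbb{R}^d}f(x)$. Let $\epsilon>0$, $\delta_1>0$, $\epsilon_S\in(0,3/4)$ and $l\in\mathbb{N}^+$ be such that $$\delta_S<\frac{c}{(c+1)^2},\qquad\left[(1-\delta_S)(1-\delta_1)-1+\frac{c}{(c+1)^2}\right]^{-1}>0,$$ where $\delta_S=e^{-\frac{l(\epsilon_S-1/4)^2}{C_3}}$ and $C_3$ is the problem-independent constant given in the context. Run the random subspace trust region algorithm of the context, with $\mathcal{S}$ the distribution of stable 1-hashing matrices in $\mathbb{R}^{l\times d}$, for $N$ iterations with $$N\ge\left[(1-\delta_S)(1-\delta_1)-1+\frac{c}{(c+1)^2}\right]^{-1}\left[\frac{f(x_0)-f^*}{h(\epsilon,\alpha_0\gamma_1^{c+\tau_\alpha})}+\frac{\tau_\alpha}{1+c}\right],$$ where $$h(\epsilon,\alpha_0\gamma_1^{c+\tau_\alpha})=\theta C_7(1-\epsilon_S)\epsilon^2\gamma_1^{c+1}\min\left\{\min\left(\frac{C_7(1-\theta)}{(L+\frac12B_{max})\lceil d/l\rceil},\frac1{B_{max}}\right),\ \frac{\alpha_0}{(1-\epsilon_S)^{1/2}\epsilon\gamma_2}\right\},$$ $$\tau_\alpha=\left\lceil\log_{\gamma_1}\left(\min\left\{\frac{\alpha_{low}}{\alpha_0},\frac1{\gamma_2}\right\}\right)\right\rceil,\qquad\alpha_{low}=(1-\epsilon_S)^{1/2}\epsilon\min\left(\frac{C_7(1-\theta)}{(L+\frac12B_{max})\lceil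 d/l\rceil},\frac1{B_{max}}\right).$$ Then $$\mathbb{P}(N\ge N_\epsilon)\ge1-e^{-\frac{\delta_1^2}{2}(1-\delta_S)N},\qquad\text{where }N_\epsilon=\min\{k:\|\nabla f(x_k)\|_2\le\epsilon\}.$$
   Context: Stable 1-hashing matrix ($l<d$): $S\in\mathbb{R}^{l\times d}$ has one non-zero per column, equal to $\pm1$ with equal probability; the row indices of the non-zeros of columns $1,\dots,d$ are obtained by randomly sampling $d$ elements without replacement from the multiset consisting of $\{1,\dots,l\}$ repeated $\lceil d/l\rceil$ times. Constant $C_3$: the problem-independent constant of the embedding result for stable 1-hashing matrices used here, which states: if $\epsilon_S\in(0,3/4)$ and $e^{-l(\epsilon_S-1/4)^2/C_3}\in(0,1/2)$, then for each fixed $y\in\{\nabla f(x):x\in\mathbb{R}^d\}$ a stable 1-hashing matrix $S\in\mathbb{R}^{l\times d}$ satisfies $\mathbb{P}(\|Sy\|_2^2\ge(1-\epsilon_S)\|y\|_2^2)\ge1-e^{-l(\epsilon_S-1/4)^2/C_3}$. Random subspace trust region algorithm. Parameters: a distribution $\mathcal{S}$ of matrices in $\mathbb{R}^{l\times d}$, $\gamma_1\in(0,1)$, $\gamma_2=\gamma_1^{-c}$ for some $c\in\mathbb{N}^+$, $\theta\in(0,1)$, $\alpha_{\max},B_{max}>0$, a constant $C_7>0$, $x_0\in\mathbb{R}^d$, $\alpha_0=\alpha_{\max}\gamma_1^p$ for some $p\in\mathbb{N}^+$. At each iteration $k=0,1,\dots$: 1. Draw $S_k$ from $\mathcal{S}$,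 independently of all previous iterations. Let $\hat m_k(\hat s)=f(x_k)+\langle S_k\nabla f(x_k),\hat s\rangle+\frac12\langle\hat s,S_kB_kS_k^T\hat s\rangle$ for $\hat s\in\mathbb{R}^l$, where $B_k\in\mathbb{R}^{d\times d}$ is a user-provided matrix with $\|B_k\|_2\le B_{max}$. Compute $\hat s_k$ such that $\|\hat s_k\|_2\le\alpha_k$ and $\hat m_k(0)-\hat m_k(\hat s_k)\ge C_7\|S_k\nabla f(x_k)\|_2\min\{\alpha_k,\|S_k\nabla f(x_k)\|_2/\|B_k\|_2\}$, and set $s_k=S_k^T\hat s_k$. 2. Sufficient decrease test: $f(x_k)-f(x_k+s_k)\ge\theta[\hat m_k(0)-\hat m_k(\hat s_k)]$. 3. If the test holds, set $x_{k+1}=x_k+s_k$, $\alpha_{k+1}=\min\{\alpha_{\max},\gamma_2\alpha_k\}$; otherwise $x_{k+1}=x_k$, $\alpha_{k+1}=\gamma_1\alpha_k$. *)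

(* Defs.v *)
From HB Require Import structures.
From mathcomp Require Export all_boot all_order all_algebra.
From mathcomp Require Export all_classical all_reals all_analysis.

Set Implicit Arguments.
Unset Strict Implicit.
Unset Printing Implicit Defensive.

Export Order.TTheory GRing.Theory Num.Theory.
Export numFieldNormedType.Exports.

Local Open Scope classical_set_scope.
Local Open Scope ring_scope.

(* The norm that MathComp-Analysis puts on matrices is the sup norm, so the
   Euclidean norm is defined here; the two induce the same topology, hence the
   same notions of differentiability and continuity. *)
Definition dot (R : realType) (n : nat) (u v : 'cV[R]_n) : R :=
  \sum_i u i 0 * v i 0.

Definition norm2 (R : realType) (n : nat) (u : 'cV[R]_n) : R :=
  Num.sqrt (dot u u).

Definition opnorm2 (R : realType) (m n : nat) (A : 'M[R]_(m, n)) : R :=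
  sup [set norm2 (A *m v) | v in [set v | norm2 v <= 1]].

Definition gradient (R : realType) (d : nat) (f : 'cV[R]_d -> R)
    (x : 'cV[R]_d) : 'cV[R]_d :=
  \col_i 'D_(delta_mx i 0) f x.

Definition continuously_differentiable (R : realType) (d : nat)
    (f : 'cV[R]_d -> R) : Prop :=
  (forall x, differentiable f x) /\ continuous (gradient f).

Definition lipschitz_gradient (R : realType) (d : nat) (f : 'cV[R]_d -> R)
    (L : R) : Prop :=
  forall x y, norm2 (gradient f x - gradient f y) <= L * norm2 (x - y).

Definition is_global_min (R : realType) (d : nat) (f : 'cV[R]_d -> R)
    (fstar : R) : Prop :=
  (exists x, f x = fstar) /\ (forall x, fstar <= f x).

Definition log_base (R : realType) (b x : R) : R := ln x / ln b.

(* ceil(d / l), for l > 0 *)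
Definition ceil_div (d l : nat) : nat := (d %/ l + ~~ (l %| d))%N.

(* The elements (i, r) of 'I_l * 'I_(ceil_div d l) are the ceil(d/l) copies of
   the row indices i, so sampling d row indices without replacement amounts to
   drawing an injective map w.1 uniformly at random; w.2 gives the signs. *)
Definition hashing_sample (l d : nat) : finType :=
  ({ffun 'I_d -> 'I_l * 'I_(ceil_div d l)} * {ffun 'I_d -> bool})%type.

Definition hashing_samples (l d : nat) : pred (hashing_sample l d) :=
  fun w => injectiveb w.1.

Definition hashing_mx (R : realType) (l d : nat) (w : hashing_sample l d) :
    'M[R]_(l, d) :=
  \matrix_(i, j) (if (w.1 j).1 == i then (-1) ^+ w.2 j else 0).

(* probability of E under the distribution of stable 1-hashing matrices *)
Definition stable_hashing_prob (R : realType) (l d : nat)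
    (E : pred 'M[R]_(l, d)) : R :=
  #|[pred w in @hashing_samples l d | E (hashing_mx R w)]|%:R
    / #|@hashing_samples l d|%:R.

Definition deltaS_of (R : realType) (C3 : R) (l : nat) (epsS : R) : R :=
  expR (- (l%:R * (epsS - 1 / 4) ^+ 2 / C3)).

(* C3 is a valid constant in the embedding result for the vectors grad f(x).
   The result is only required of the given f: no C3 works for all vectors y of
   all dimensions, since a vector with two equal nonzero entries is mapped to 0
   with probability of order 1 / l. *)
Definition hashing_embedding_constant (R : realType) (d : nat)
    (f : 'cV[R]_d -> R) (C3 : R) : Prop :=
  forall (l : nat) (epsS : R), (0 < l)%N -> (l < d)%N ->
    0 < epsS < 3 / 4 -> 0 < deltaS_of C3 l epsS < 1 / 2 ->
  forall y : 'cV[R]_d, range (gradient f) y ->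
    stable_hashing_prob (fun S : 'M[R]_(l, d) =>
        (1 - epsS) * norm2 y ^+ 2 <= norm2 (S *m y) ^+ 2)
      >= 1 - deltaS_of C3 l epsS.

Section random_matrices.
Context {R : realType} {disp : measure_display} {Omega : measurableType disp}.

Definition entry_events (m n : nat) (X : Omega -> 'M[R]_(m, n)) :
    set (set Omega) :=
  [set A | exists i j (Y : set R),
     measurable Y /\ A = (fun w => X w i j) @^-1` Y].

Definition random_matrix (m n : nat) (X : Omega -> 'M[R]_(m, n)) : Prop :=
  forall i j, measurable_fun setT (fun w => X w i j).

Definition independent_sigma (P : probability Omega R)
    (F G : set (set Omega)) : Prop :=
  forall A B, F A -> G B -> P (A `&` B) = (P A * P B)%E.

Definition stable_hashing (P : probability Omega R) (l d : nat)
    (S : Omega -> 'M[R]_(l, d)) : Prop :=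
  random_matrix S /\
  forall M, P (S @^-1` [set M]) = (stable_hashing_prob (pred1 M))%:E.

End random_matrices.

Definition reduced_model (R : realType) (l d : nat) (f : 'cV[R]_d -> R)
    (x : 'cV[R]_d) (S : 'M[R]_(l, d)) (B : 'M[R]_d) (s : 'cV[R]_l) : R :=
  f x + dot (S *m gradient f x) s + 1 / 2 * dot s (S *m B *m S^T *m s).

(* min {a, g / b}, with g / 0 read as +oo (MathComp would give 0) *)
Definition cauchy_radius (R : realType) (a g b : R) : R :=
  if b == 0 then a else Num.min a (g / b).

Record trust_region_step (R : realType) (l d : nat) (f : 'cV[R]_d -> R)
    (gamma1 gamma2 theta alpha_max Bmax C7 : R)
    (S : 'M[R]_(l, d)) (B : 'M[R]_d) (shat : 'cV[R]_l)
    (x : 'cV[R]_d) (alpha : R) (x' : 'cV[R]_d) (alpha' : R) : Prop :=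
  TrustRegionStep {
    step_B_bound : opnorm2 B <= Bmax ;
    step_radius : norm2 shat <= alpha ;
    step_model_decrease :
      reduced_model f x S B 0 - reduced_model f x S B shat >=
      C7 * norm2 (S *m gradient f x)
        * cauchy_radius alpha (norm2 (S *m gradient f x)) (opnorm2 B) ;
    step_update :
      (x', alpha') =
      if f x - f (x + S^T *m shat) >=
         theta * (reduced_model f x S B 0 - reduced_model f x S B shat)
      then (x + S^T *m shat, Num.min alpha_max (gamma2 * alpha))
      else (x, gamma1 * alpha)
  }.

(* sigma-algebra generated by the random quantities of iterations 0 .. k-1 *)
Definition history (R : realType) (disp : measure_display)
    (Omega : measurableType disp) (l d : nat)
    (S : nat -> Omega -> 'M[R]_(l, d)) (B : nat -> Omega -> 'M[R]_d)
    (shat : nat -> Omega -> 'cV[R]_l) (k : nat) : set (set Omega) :=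
  <<s \bigcup_(j in [set j | (j < k)%N])
        (entry_events (S j) `|` entry_events (B j) `|` entry_events (shat j)) >>.

(* N iterations of the algorithm: iteration k goes from (x k, alpha k) to
   (x k.+1, alpha k.+1). The distribution from which the S k are drawn is given
   by the class calS of the random matrices having it. B k and shat k are
   arbitrary random choices, possibly depending on S k. *)
Record random_subspace_trust_region (R : realType) (disp : measure_display)
    (Omega : measurableType disp) (P : probability Omega R) (l d : nat)
    (f : 'cV[R]_d -> R) (calS : set (Omega -> 'M[R]_(l, d)))
    (gamma1 gamma2 theta alpha_max Bmax C7 : R) (x0 : 'cV[R]_d) (alpha0 : R)
    (N : nat)
    (S : nat -> Omega -> 'M[R]_(l, d)) (B : nat -> Omega -> 'M[R]_d)
    (shat : nat -> Omega -> 'cV[R]_l)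
    (x : nat -> Omega -> 'cV[R]_d) (alpha : nat -> Omega -> R) : Prop :=
  RandomSubspaceTrustRegion {
    run_x0 : forall w, x 0%N w = x0 ;
    run_alpha0 : forall w, alpha 0%N w = alpha0 ;
    run_S_law : forall k, (k < N)%N -> calS (S k) ;
    run_S_indep : forall k, (k < N)%N ->
      independent_sigma P (history S B shat k) <<s entry_events (S k) >> ;
    run_B_random : forall k, (k < N)%N -> random_matrix (B k) ;
    run_shat_random : forall k, (k < N)%N -> random_matrix (shat k) ;
    run_step : forall k w, (k < N)%N ->
      trust_region_step f gamma1 gamma2 theta alpha_max Bmax C7
        (S k w) (B k w) (shat k w) (x k w) (alpha k w)
        (x k.+1 w) (alpha k.+1 w)
  }.

(* min of a set of naturals, equal to +oo if no iterate is epsilon-stationary.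
   For a run of N iterations, the iterates after the N-th are unconstrained but
   do not affect the event N_eps <= N. *)
Definition N_eps (R : realType) (Omega : Type) (d : nat) (f : 'cV[R]_d -> R)
    (eps : R) (x : nat -> Omega -> 'cV[R]_d) (w : Omega) : \bar R :=
  ereal_inf [set (k%:R)%:E | k in [set k | norm2 (gradient f (x k w)) <= eps]].

Section complexity_quantities.
Context {R : realType}.
Variables (l d c : nat) (gamma1 gamma2 theta Bmax C7 L eps epsS alpha0 : R).

Definition curvature_min : R :=
  Num.min (C7 * (1 - theta) / ((L + 1 / 2 * Bmax) * (ceil_div d l)%:R))
          (1 / Bmax).

Definition alpha_low : R := Num.sqrt (1 - epsS) * eps * curvature_min.

Definition tau_alpha : int :=
  Num.ceil (log_base gamma1 (Num.min (alpha_low / alpha0) (1 / gamma2))).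

(* the value of h(epsilon, alpha0 * gamma1 ^ (c + tau_alpha)) *)
Definition h_value : R :=
  theta * C7 * (1 - epsS) * eps ^+ 2 * gamma1 ^+ c.+1
  * Num.min curvature_min (alpha0 / (Num.sqrt (1 - epsS) * eps * gamma2)).

End complexity_quantities.

(* Main.v *)
Require Import Defs.
From mathcomp Require Import measurable_realfun.
From mathcomp Require Import ring lra zify.

(* Call iteration k true if S_k is one of the hashing matrices and does not shrink
   the gradient at x_k by more than the factor allowed by the embedding result.

   As long as the gradients exceed eps, a true iteration with
   radius at most alpha_low is successful (mean value theorem, together with
   |S^T s|^2 <= ceil(d/l) |s|^2), and a true successful iteration whose radius is
   not too small decreases f by at least h. Writing the radii as
   alpha_max * gamma1^(e_k) and bounding the motion of e_k, at most
   (f(x_0) - fstar)/h + c/(c+1) N + tau/(c+1) iterations are true.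

   On the other hand, x_k is measurable with respect to the history, from which S_k is
   independent, so each iteration is true with conditional probability at least
   1 - deltaS, and a Chernoff bound shows that fewer than
   (1 - delta1)(1 - deltaS) N iterations are true with small probability.

   The bound on N makes the two estimates contradictory when N < N_eps. *)

Set Implicit Arguments.
Unset Strict Implicit.
Unset Printing Implicit Defensive.

Local Open Scope classical_set_scope.
Local Open Scope ring_scope.

(** * Euclidean norm, hashing matrices and descent *)

Lemma dotC (R : realType) n (u v : 'cV[R]_n) : dot u v = dot v u.
Proof. by apply: eq_bigr => i _; rewrite mulrC. Qed.

Lemma dotDr (R : realType) n (u v w : 'cV[R]_n) :
  dot u (v + w) = dot u v + dot u w.
Proof. by rewrite -big_split; apply: eq_bigr => i _; rewrite mxE mulrDr. Qed.

Lemma dotZr (R : realType) n (a : R) (u v : 'cV[R]_n) :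
  dot u (a *: v) = a * dot u v.
Proof. by rewrite mulr_sumr; apply: eq_bigr => i _; rewrite mxE mulrCA. Qed.

Lemma dotDl (R : realType) n (u v w : 'cV[R]_n) :
  dot (u + v) w = dot u w + dot v w.
Proof. by rewrite dotC dotDr !(dotC w). Qed.

Lemma dotZl (R : realType) n (a : R) (u v : 'cV[R]_n) :
  dot (a *: u) v = a * dot u v.
Proof. by rewrite dotC dotZr dotC. Qed.

Lemma dotBl (R : realType) n (u v w : 'cV[R]_n) :
  dot (u - v) w = dot u w - dot v w.
Proof. by rewrite dotDl -scaleN1r dotZl mulN1r. Qed.

Lemma dot0r (R : realType) n (u : 'cV[R]_n) : dot u 0 = 0.
Proof. by rewrite /dot big1 // => i _; rewrite mxE mulr0. Qed.

Lemma dot_mulmx (R : realType) m n (A : 'M[R]_(m, n)) u v :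
  dot (A *m u) v = dot u (A^T *m v).
Proof.
pose E i j : R := A i j * u j 0 * v i 0.
transitivity (\sum_i \sum_j E i j).
  by apply: eq_bigr => i _; rewrite mxE mulr_suml.
rewrite exchange_big; apply: eq_bigr => j _; rewrite mxE mulr_sumr.
by apply: eq_bigr => i _; rewrite mxE /E; ring.
Qed.

Lemma dot_ge0 (R : realType) n (u : 'cV[R]_n) : 0 <= dot u u.
Proof. by apply: sumr_ge0 => i _; rewrite -expr2 sqr_ge0. Qed.

Lemma norm2_ge0 (R : realType) n (u : 'cV[R]_n) : 0 <= norm2 u.
Proof. exact: sqrtr_ge0. Qed.

Lemma norm2_sqr (R : realType) n (u : 'cV[R]_n) : norm2 u ^+ 2 = dot u u.
Proof. by rewrite sqr_sqrtr ?dot_ge0. Qed.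

Lemma norm2_0 (R : realType) n : norm2 (0 : 'cV[R]_n) = 0.
Proof. by rewrite /norm2 dot0r sqrtr0. Qed.

Lemma norm2Z (R : realType) n (a : R) (u : 'cV[R]_n) :
  norm2 (a *: u) = `|a| * norm2 u.
Proof.
rewrite /norm2 dotZr dotC dotZr mulrA -expr2 sqrtrM ?sqr_ge0 //.
by rewrite sqrtr_sqr.
Qed.

(** Expand the nonnegative square norm of [(u.u) v - (u.v) u] and cancel the factor [u.u]; the case
    [u.u = 0] forces [u = 0] and is treated apart. *)
Lemma CauchySchwarz_dot (R : realType) n (u v : 'cV[R]_n) :
  `|dot u v| <= norm2 u * norm2 v.
Proof.
rewrite -ler_sqr ?nnegrE ?mulr_ge0 ?norm2_ge0 //.
rewrite exprMn real_normK ?num_real // !norm2_sqr.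
have nnuu := dot_ge0 u; have nnvv := dot_ge0 v.
have [uu0|uu0] := eqVneq (dot u u) 0.
  have u0 i : u i 0 = 0.
    apply/eqP; rewrite -sqrf_eq0; apply/eqP.
    by rewrite expr2; move: uu0 => /psumr_eq0P -> // j _; rewrite -expr2 sqr_ge0.
  rewrite uu0 mul0r /dot big1 ?expr0n // => i _.
  by rewrite u0 mul0r.
have := dot_ge0 (dot u u *: v + - dot u v *: u).
rewrite !(dotDl, dotDr, dotZl, dotZr) (dotC v u) => H.
have : 0 <= dot u u * (dot u u * dot v v - dot u v ^+ 2) by nra.
by rewrite pmulr_rge0 ?subr_ge0// lt0r uu0.
Qed.

Lemma dot_le_norm2 (R : realType) n (u v : 'cV[R]_n) :
  dot u v <= norm2 u * norm2 v.
Proof. exact: le_trans (ler_norm _) (CauchySchwarz_dot u v). Qed.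

Lemma norm2_eq0 (R : realType) n (u : 'cV[R]_n) : norm2 u = 0 -> u = 0.
Proof.
move=> u0; apply/colP => i; rewrite mxE.
have := CauchySchwarz_dot (delta_mx i 0) u.
rewrite u0 mulr0 normr_le0 /dot (bigD1 i)//= !mxE !eqxx mul1r big1 ?addr0.
  by move/eqP.
by move=> j /negPf ji; rewrite mxE ji mul0r.
Qed.

(** The Frobenius norm is a bound, by Cauchy-Schwarz on each row. Without boundedness the [sup] in
    [opnorm2] would carry no information. *)
Lemma norm2_mulmx_bounded (R : realType) m n (A : 'M[R]_(m, n)) :
  has_ubound [set norm2 (A *m v) | v in [set v | norm2 v <= 1]].
Proof.
exists (Num.sqrt (\sum_i norm2 (row i A)^T ^+ 2)) => _ [v /= v1 <-].
apply: ler_wsqrtr; apply: ler_sum => i _; rewrite -expr2.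
have -> : (A *m v) i 0 = dot (row i A)^T v.
  by rewrite mxE; apply: eq_bigr => j _; rewrite !mxE.
rewrite -real_normK ?num_real // ler_sqr ?nnegrE ?norm2_ge0 //.
apply: le_trans (CauchySchwarz_dot _ _) _.
by rewrite ler_piMr ?norm2_ge0.
Qed.

Lemma opnorm2_ge0 (R : realType) m n (A : 'M[R]_(m, n)) : 0 <= opnorm2 A.
Proof.
apply: (ub_le_sup (norm2_mulmx_bounded A)); exists 0 => /=.
  by rewrite norm2_0 ler01.
by rewrite mulmx0 norm2_0.
Qed.

Lemma norm2_mulmx_le (R : realType) m n (A : 'M[R]_(m, n)) v :
  norm2 (A *m v) <= opnorm2 A * norm2 v.
Proof.
have [/norm2_eq0 ->|v0] := eqVneq (norm2 v) 0.
  by rewrite mulmx0 !norm2_0 mulr0.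
have vgt0 : 0 < norm2 v by rewrite lt0r v0 norm2_ge0.
rewrite -ler_pdivrMr //.
apply: (ub_le_sup (norm2_mulmx_bounded A)); exists ((norm2 v)^-1 *: v) => /=.
  by rewrite norm2Z ger0_norm ?invr_ge0 ?norm2_ge0 // mulVf.
by rewrite -scalemxAr norm2Z ger0_norm ?invr_ge0 ?norm2_ge0 // mulrC.
Qed.

(** Each column has a single entry, a sign, so [|S^T s|^2] counts every [s_i ^ 2] once per column
    sent to row [i]. Those columns occupy distinct copies of [i] by injectivity, so there are at
    most [ceil_div d l] of them. *)
Lemma hashing_mx_tr_norm (R : realType) l d (w : hashing_sample l d) s :
  w \in @hashing_samples l d ->
  norm2 ((hashing_mx R w)^T *m s) ^+ 2 <= (ceil_div d l)%:R * norm2 s ^+ 2.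
Proof.
rewrite unfold_in => /injectiveP winj; rewrite !norm2_sqr.
have E j : ((hashing_mx R w)^T *m s) j 0 = (-1) ^+ w.2 j * s (w.1 j).1 0.
  rewrite mxE (bigD1 (w.1 j).1) //= !mxE eqxx big1 ?addr0 // => i.
  by rewrite eq_sym => /negPf H; rewrite !mxE H mul0r.
have -> : dot ((hashing_mx R w)^T *m s) ((hashing_mx R w)^T *m s) =
    \sum_i \sum_(j | (w.1 j).1 == i) s i 0 * s i 0.
  rewrite (exchange_big_dep xpredT) //=; apply: eq_bigr => j _.
  rewrite (big_pred1 (w.1 j).1) => [|i]; last exact: eq_sym.
  by rewrite E mulrACA -expr2 sqrr_sign mul1r.
rewrite mulr_sumr; apply: ler_sum => i _; rewrite sumr_const -[leLHS]mulr_natl.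
apply: ler_wpM2r; first by rewrite -expr2 sqr_ge0.
rewrite ler_nat -[leqRHS]card_ord.
rewrite -(card_in_imset (f := fun j => (w.1 j).2)); first exact: max_card.
move=> j k /eqP jE /eqP kE jk; apply: winj.
have {jE} jE : (w.1 j).1 = (w.1 k).1 by apply: val_inj; exact: etrans jE (esym kE).
by rewrite (surjective_pairing (w.1 j)) (surjective_pairing (w.1 k)) jE jk.
Qed.

Lemma derive_gradient (R : realType) d (f : 'cV[R]_d -> R) (x s : 'cV[R]_d) :
  differentiable f x -> 'D_s f x = dot (gradient f x) s.
Proof.
move=> df; rewrite deriveE // {1}(matrix_sum_delta s) linear_sum.
apply: eq_bigr => i _; rewrite big_ord1 linearZ /= mxE deriveE //.
by rewrite mulrC.
Qed.

(** One-variable mean value theorem for [t |-> f (x + t s)] on [[0, 1]]. *)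
Lemma mean_value_gradient (R : realType) d (f : 'cV[R]_d -> R) (x s : 'cV[R]_d) :
  (forall y, differentiable f y) ->
  exists2 t, 0 <= t <= 1 & f (x + s) - f x = dot (gradient f (x + t *: s)) s.
Proof.
move=> df; pose phi (t : R) := f (x + t *: s).
have dphi (t : R) : is_derive t (1 : R) phi (dot (gradient f (x + t *: s)) s).
  have fs : derivable f (x + t *: s) s by exact/diff_derivable/df.
  have E : (fun h : R => h^-1 *: (phi (h *: 1 + t) - phi t)) =
      (fun h : R => h^-1 *: (f (h *: s + (x + t *: s)) - f (x + t *: s))).
    apply/funext => h; rewrite /phi; congr (_ *: (f _ - _)).
    by rewrite /= [h *: 1]mulr1 scalerDl addrCA.
  apply: DeriveDef; first by rewrite /derivable E.
  by rewrite -derive_gradient // /derive E.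
have cphi (t : R) : {for t, continuous phi}.
  apply: differentiable_continuous; apply/derivable1_diffP.
  by case: (dphi t).
have [|t t01 Et] := MVT_segment (ler01 : 0 <= 1 :> R) (f := phi)
  (df := fun t => dot (gradient f (x + t *: s)) s).
  by apply: continuous_subspaceT => t; exact: cphi.
exists t; first by rewrite in_itv /= in t01.
by move: Et; rewrite /phi scale1r scale0r addr0 subr0 mulr1.
Qed.

(** Compare the gradients at a unit vector and at 0; a unit vector exists because the dimension is
    positive. *)
Lemma lipschitz_gradient_ge0 (R : realType) d (f : 'cV[R]_d -> R) L :
  (0 < d)%N -> lipschitz_gradient f L -> 0 <= L.
Proof.
case: d f => // d f _ /(_ (delta_mx 0 0) 0); rewrite subr0.
have -> : norm2 (delta_mx 0 0 : 'cV[R]_d.+1) = 1.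
  rewrite /norm2 /dot (bigD1 0) //= big1 => [|i /negPf i0].
    by rewrite !mxE !eqxx mulr1 addr0 sqrtr1.
  by rewrite !mxE i0 mul0r.
by rewrite mulr1; apply: le_trans; exact: norm2_ge0.
Qed.

(* The sharp constant is [L / 2], but the mean value theorem directly gives [L],
   which is the constant of the theorem. *)
Lemma descent_lemma (R : realType) d (f : 'cV[R]_d -> R) L (x s : 'cV[R]_d) :
  (0 < d)%N -> (forall y, differentiable f y) -> lipschitz_gradient f L ->
  f (x + s) <= f x + dot (gradient f x) s + L * norm2 s ^+ 2.
Proof.
move=> d0 df fL; have L0 := lipschitz_gradient_ge0 d0 fL.
have [t /andP[t0 t1] E] := mean_value_gradient x s df.
suff : dot (gradient f (x + t *: s) - gradient f x) s <= L * norm2 s ^+ 2.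
  by rewrite dotBl -E; lra.
apply: le_trans (dot_le_norm2 _ _) _; rewrite expr2 mulrA.
apply: ler_wpM2r; first exact: norm2_ge0.
apply: le_trans (fL _ _) _; rewrite ler_wpM2l //.
rewrite addrAC subrr add0r norm2Z ger0_norm // ler_piMl //.
exact: norm2_ge0.
Qed.

(** * One trust region step *)

Lemma cauchy_radius_ge (R : realType) (a g G b Bmax : R) :
  0 <= b -> b <= Bmax -> 0 <= g -> g <= G ->
  Num.min a (g / Bmax) <= cauchy_radius a G b.
Proof.
move=> b0 bB g0 gG; rewrite /cauchy_radius; case: eqVneq => [_|bn0].
  by rewrite ge_min lexx.
have bgt0 : 0 < b by rewrite lt0r bn0.
rewrite le_min !ge_min lexx /=; apply/orP; right.
by apply: ler_pM => //; rewrite ?invr_ge0 ?lef_pV2 ?posrE// ?(lt_le_trans bgt0)//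
  (le_trans b0).
Qed.

(** The Cauchy decrease is monotone in the sketched gradient norm and antitone in the norm of [B],
    so both may be replaced by the uniform bounds [g] and [Bmax]. *)
Lemma reduced_model_decrease (R : realType) l d (f : 'cV[R]_d -> R)
    gamma1 gamma2 theta alpha_max Bmax C7 S B (shat : 'cV[R]_l) x alpha x' alpha' g :
  0 < C7 -> 0 <= g -> g <= norm2 (S *m gradient f x) -> 0 <= alpha ->
  0 <= Bmax ->
  trust_region_step f gamma1 gamma2 theta alpha_max Bmax C7
    S B shat x alpha x' alpha' ->
  C7 * g * Num.min alpha (g / Bmax) <=
    reduced_model f x S B 0 - reduced_model f x S B shat.
Proof.
move=> C70 g0 gG a0 B0 [Bb _ dec _].
apply: le_trans dec; rewrite -!mulrA; apply: ler_wpM2l; first exact: ltW.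
apply: ler_pM => //; first by rewrite le_min a0 divr_ge0.
exact: cauchy_radius_ge (opnorm2_ge0 _) _ _ _.
Qed.

Lemma reduced_model0 (R : realType) l d (f : 'cV[R]_d -> R) x
  (S : 'M[R]_(l, d)) B : reduced_model f x S B 0 = f x.
Proof. by rewrite /reduced_model mulmx0 !dot0r mulr0 !addr0. Qed.

(** The actual and the model decrease differ by at most [(L + Bmax / 2) |s|^2 <= (L + Bmax / 2) K
    alpha^2], while the model decrease is at least [C7 g alpha]. For a small radius the error is
    thus at most the fraction [1 - theta] of the model decrease. *)
Lemma small_radius_sufficient_decrease (R : realType) l d
    (f : 'cV[R]_d -> R) L gamma1 gamma2 theta alpha_max Bmax C7 K
    S B (shat : 'cV[R]_l) x alpha x' alpha' g :
  (0 < d)%N -> (forall y, differentiable f y) -> lipschitz_gradient f L ->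
  0 <= K -> (forall s, norm2 (S^T *m s) ^+ 2 <= K * norm2 s ^+ 2) ->
  theta <= 1 -> 0 < C7 -> 0 < Bmax ->
  0 <= g -> g <= norm2 (S *m gradient f x) ->
  0 <= alpha -> alpha * ((L + 1 / 2 * Bmax) * K) <= g * (C7 * (1 - theta)) ->
  alpha <= g / Bmax ->
  trust_region_step f gamma1 gamma2 theta alpha_max Bmax C7
    S B shat x alpha x' alpha' ->
  f x - f (x + S^T *m shat) >=
    theta * (reduced_model f x S B 0 - reduced_model f x S B shat).
Proof.
move=> d0 df fL K0 SK th1 C70 B0 g0 gG a0 alow1 alow2 st.
have := reduced_model_decrease C70 g0 gG a0 (ltW B0) st.
case: st => Bb sa _ _; rewrite (min_idPl alow2) reduced_model0.
set q := f x - reduced_model _ _ _ _ _ => decq.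
have L0 := lipschitz_gradient_ge0 d0 fL.
have := descent_lemma x (S^T *m shat) d0 df fL; rewrite -dot_mulmx.
set s := S^T *m shat; set Df := dot (S *m _) _ => Hf.
(* The linear term [Df] is the same in the model and in the descent inequality, once [S^T] has been
   moved across the dot product; only the quadratic terms remain to be compared. *)
have Eq : q = - Df - 1 / 2 * dot shat (S *m B *m S^T *m shat).
  by rewrite /q /reduced_model -/Df; ring.
have HB : `|dot shat (S *m B *m S^T *m shat)| <= Bmax * norm2 s ^+ 2.
  rewrite -!mulmxA dotC dot_mulmx dotC.
  apply: le_trans (CauchySchwarz_dot _ _) _.
  rewrite [leRHS]mulrC expr2 -mulrA ler_wpM2l ?norm2_ge0// mulrC.
  apply: le_trans (norm2_mulmx_le _ _) _; rewrite ler_wpM2r ?norm2_ge0//.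
have ns : norm2 s ^+ 2 <= K * alpha ^+ 2.
  apply: le_trans (SK _) _; rewrite ler_wpM2l // ler_sqr // nnegrE ?norm2_ge0//.
have : (L + 1 / 2 * Bmax) * norm2 s ^+ 2 <= (1 - theta) * q.
  apply: (@le_trans _ _ ((1 - theta) * (C7 * g * alpha))); last first.
    by rewrite ler_wpM2l // subr_ge0.
  apply: (@le_trans _ _ ((L + 1 / 2 * Bmax) * (K * alpha ^+ 2))).
    by rewrite ler_wpM2l //; lra.
  have := ler_wpM2r a0 alow1; rewrite expr2; lra.
move: HB; rewrite ler_norml => /andP[HB1 HB2]; nra.
Qed.

(** Since [gamma2] is a power of [gamma1], radii stay on the grid [alpha_max * gamma1 ^+ e].
    Truncated subtraction on exponents is exactly the cap at [alpha_max], which is exponent 0. *)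
Lemma trust_region_step_radius (R : realType) l d (f : 'cV[R]_d -> R)
    gamma1 theta alpha_max Bmax C7 c e S B (shat : 'cV[R]_l) x alpha x' alpha' :
  0 < gamma1 < 1 -> 0 < alpha_max ->
  trust_region_step f gamma1 (gamma1 ^- c) theta alpha_max Bmax C7
    S B shat x alpha x' alpha' ->
  alpha = alpha_max * gamma1 ^+ e ->
  alpha' = alpha_max * gamma1 ^+
    (if f x - f (x + S^T *m shat) >=
        theta * (reduced_model f x S B 0 - reduced_model f x S B shat)
     then (e - c)%N else e.+1).
Proof.
move=> /andP[g0 g1] am0 [_ _ _ up] aE; move: up; case: ifP => _ [_ ->];
  rewrite {}aE; last first.
  by rewrite exprS mulrCA.
rewrite mulrCA; have [ce|ec] := leqP c e.
  have -> : gamma1 ^- c * gamma1 ^+ e = gamma1 ^+ (e - c).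
    by rewrite -[in LHS](subnK ce) exprD mulrCA mulVf ?mulr1// expf_neq0 ?gt_eqF.
  by rewrite (min_idPr _)// ler_piMr ?(ltW am0)// exprn_ile1 ?ltW.
have -> : (e - c = 0)%N by lia.
rewrite expr0 mulr1 (min_idPl _)// ler_peMr ?(ltW am0)//.
rewrite mulrC ler_pdivlMr ?exprn_gt0// mul1r.
by apply: ler_wiXn2l; rewrite ?ltW// ltnW.
Qed.

(** The bound [g = 0] already makes the model decrease nonnegative, hence also the decrease of [f]
    at an accepted step. *)
Lemma trust_region_step_le (R : realType) l d (f : 'cV[R]_d -> R)
    gamma1 gamma2 theta alpha_max Bmax C7 S B (shat : 'cV[R]_l) x alpha x' alpha' :
  0 <= theta -> 0 < C7 -> 0 <= alpha -> 0 <= Bmax ->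
  trust_region_step f gamma1 gamma2 theta alpha_max Bmax C7
    S B shat x alpha x' alpha' ->
  f x' <= f x.
Proof.
move=> th0 C70 a0 B0 st.
have := reduced_model_decrease C70 (lexx 0) (norm2_ge0 _) a0 B0 st.
rewrite mulr0 mul0r => dec; case: st => _ _ _.
case: ifP => [H|_] [-> _] //.
by rewrite -subr_ge0; apply: le_trans H; rewrite mulr_ge0.
Qed.

(* Potential argument behind the bound on the number of true iterations. The
   radius is [alpha_max * gamma1 ^+ e k]. Above the level [E + c], true steps
   decrease [e k - E] by [c], and only false steps increase it; below [E], an
   unsuccessful true step increases [e k] by one, which must be paid for by
   successful steps, each of which decreases it by at most [c]. *)
Lemma count_true_iterations (c E : nat) (T U : nat -> bool) (e : nat -> nat) N :
  (0 < c)%N -> (e 0 <= E)%N ->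
  (forall k, (k < N)%N -> e k.+1 = if U k then (e k - c)%N else (e k).+1) ->
  (forall k, (k < N)%N -> T k -> (E <= e k)%N -> U k) ->
  (c.+1 * (\sum_(k < N) T k) <=
     c.+1 * (\sum_(k < N) [&& T k, U k & (e k <= E + c)%N])
     + c * N + (E - e 0))%N.
Proof.
move=> c0 e0 eS TU.
pose a k := [&& T k, U k & (e k <= E + c)%N].
pose b k := T k && ~~ U k.
pose c' k := [&& T k, U k & (E + c < e k)%N].
pose fs k := ~~ T k && U k.
pose fu k := ~~ T k && ~~ U k.
(* First invariant: the excess of [e] over [E] grows only by [fu] and loses [c] at each [c'].
   Second: [minn (e k) E] gains one at each [b], which occurs only below [E], and loses at most [c]
   at each [a] or [fs]. The last two are partitions of the true and of all iterations. *)
have [A1 A2 A3 A4] : [/\ (c * (\sum_(k < N) c' k) + (e N - E) <= \sum_(k < N) fu k)%N,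
  ((\sum_(k < N) b k) + e 0 <=
     minn (e N) E + c * ((\sum_(k < N) a k) + \sum_(k < N) fs k))%N,
  ((\sum_(k < N) T k) =
     (\sum_(k < N) a k) + (\sum_(k < N) b k) + \sum_(k < N) c' k)%N &
  (N = (\sum_(k < N) T k) + (\sum_(k < N) fs k) + \sum_(k < N) fu k)%N].
  elim: N eS TU => [|N IH] eS TU; first by rewrite !big_ord0; split; lia.
  have [] := IH (fun k h => eS k (ltnW h)) (fun k h => TU k (ltnW h)).
  rewrite !big_ord_recr /= (eS N (ltnSn N)); have := TU N (ltnSn N).
  move: (\sum_(i < N) _)%N (\sum_(i < N) _)%N (\sum_(i < N) _)%N
        (\sum_(i < N) _)%N (\sum_(i < N) _)%N (\sum_(i < N) _)%N => s1 s2 s3 s4 s5 s6.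
  rewrite /a /b /c' /fs /fu ltnNge.
  case: (T N) (U N) => [] [] /=; case: (leqP (e N) (E + c)) => h1 h2 [] /= H1 H2 H3 H4;
    (split; [| |lia|lia]); 
    try (have {}h2 := h2 isT);
    move: H1 H2 h1 h2; rewrite ?(addn0, mulnDr, muln1); clear; lia.
move: A1 A2 A3 A4; rewrite -/a; clear -c0.
move: (\sum_(i < N) _)%N (\sum_(i < N) _)%N (\sum_(i < N) _)%N
      (\sum_(i < N) _)%N (\sum_(i < N) _)%N (\sum_(i < N) _)%N => s1 s2 s3 s4 s5 s6.
(* With [c >= 1] the first invariant gives [c' <= fu <= c * fu]; the second bounds [b] by
   [c * (a + fs) + (E - e 0)]. *)
nia.
Qed.

(** * Chernoff bound *)

(** The difference of the two sides vanishes at 0 and has derivative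
    [(e^(t/2) - e^(-t/2))^2 >= 0]. *)
Lemma expR_sinh_ge (R : realType) (s : R) : 0 <= s -> 2 * s <= expR s - expR (- s).
Proof.
move=> s0; pose h (t : R) := expR t - expR (- t) - 2 * t.
have dh (t : R) : is_derive t (1 : R) h (expR t + expR (- t) - 2).
  rewrite /h; apply: is_derive_eq; rewrite /GRing.scale /=; ring.
have ch : {within `[0, s], continuous h}.
  apply: continuous_subspaceT => t; apply: differentiable_continuous.
  by apply/derivable1_diffP; case: (dh t).
have [t t01 E] := MVT_segment s0 (fun t _ => dh t) ch.
have : 0 <= h s - h 0.
  rewrite E subr0 mulr_ge0 //.
  have Ea : expR t = expR (t / 2) ^+ 2 by rewrite expr2 -expRD -splitr.
  have Eb : expR (- t) = expR (- (t / 2)) ^+ 2.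
    by rewrite expr2 -expRD -opprD -splitr.
  have Eab : expR (t / 2) * expR (- (t / 2)) = 1 by rewrite -expRD subrr expR0.
  have := sqr_ge0 (expR (t / 2) - expR (- (t / 2))).
  by rewrite Ea Eb sqrrB Eab; lra.
by rewrite /h oppr0 expR0; lra.
Qed.

(** Take [s = - ln (1 - x)] in the previous inequality and multiply by [1 - x]. *)
Lemma chernoff_exponent (R : realType) (x : R) : 0 <= x < 1 ->
  x ^+ 2 / 2 - x <= (1 - x) * ln (1 - x).
Proof.
move=> /andP[x0 x1]; have t0 : 0 < 1 - x by lra.
have := @expR_sinh_ge R (- ln (1 - x)).
rewrite opprK expRN lnK ?posrE// oppr_ge0 => /(_ (ln_le0 _)) H.
have {}H := H ltac:(lra).
have := ler_wpM2l (ltW t0) H; rewrite mulrBr mulfV ?gt_eqF//; lra.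
Qed.

Lemma prU (R : realType) (disp : measure_display)
    (Omega : measurableType disp) (P : probability Omega R) A B :
  measurable A -> measurable B -> A `&` B = set0 ->
  fine (P (A `|` B)) = fine (P A) + fine (P B).
Proof.
move=> mA mB AB; rewrite measureU // fineD //; exact: fin_num_measure.
Qed.

Lemma pr_ge0 (R : realType) (disp : measure_display)
    (Omega : measurableType disp) (P : probability Omega R) A :
  0 <= fine (P A).
Proof. exact/fine_ge0/measure_ge0. Qed.

Lemma pr_split (R : realType) (disp : measure_display)
    (Omega : measurableType disp) (P : probability Omega R) A B :
  measurable A -> measurable B ->
  fine (P A) = fine (P (A `&` B)) + fine (P (A `\` B)).
Proof.
move=> mA mB; rewrite -prU.
- by rewrite setUIDK.
- exact: measurableI.
- exact: measurableD.
- by rewrite setDE setIACA setICr setI0.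
Qed.

(** Total probability over finitely many values of [g]. Measurability is asked of the pieces, so it
    applies to a [g] into a type without sigma-algebra. *)
Lemma pr_preimage_sum (R : realType) (disp : measure_display)
    (Omega : measurableType disp) (P : probability Omega R)
    (I : choiceType) (g : Omega -> I) (A : set Omega) (r : seq I) :
  (forall i, i \in r -> measurable (A `&` g @^-1` [set i])) -> uniq r ->
  (forall w, A w -> g w \in r) ->
  fine (P A) = \sum_(i <- r) fine (P (A `&` g @^-1` [set i])).
Proof.
elim: r A => [|i r IH] A mA /=; first by move=> _ Ar; rewrite big_nil
  (_ : A = set0) ?measure0 // -subset0 => w /Ar.
move=> /andP[ir ur] Ar.
have Ei j : j \in r -> (A `\` g @^-1` [set i]) `&` g @^-1` [set j] =
    A `&` g @^-1` [set j].
  move=> jr; apply/seteqP; split => w /= [] => [[? ?] ?|? ->]; first by split.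
  by do 2 split => //; move=> ji; move: ir; rewrite -ji jr.
have EA : A = (A `&` g @^-1` [set i]) `|` (A `\` g @^-1` [set i]).
  by rewrite setUIDK.
have AD w : (A `\` g @^-1` [set i]) w -> g w \in r.
  by move=> [/Ar]; rewrite inE => /orP[/eqP|//].
have mD : measurable (A `\` g @^-1` [set i]).
  rewrite (_ : _ `\` _ = \big[setU/set0]_(j <- r) (A `&` g @^-1` [set j])).
    rewrite big_seq; apply: bigsetU_measurable => j jr.
    by apply: mA; rewrite inE jr orbT.
  rewrite -bigcup_seq; apply/seteqP; split => w /=.
    by move=> Aw; exists (g w) => /=; [exact: AD|case: Aw].
  move=> [j /= jr [Aw gj]]; split=> // gi.
  by move: ir; rewrite -gi gj jr.
rewrite big_cons [in LHS]EA prU //; first last.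
- by rewrite setDE setIACA setICr setI0.
- by apply: mA; rewrite inE eqxx.
congr (_ + _); rewrite (IH _ _ ur AD); last first.
  by move=> j jr; rewrite Ei //; apply: mA; rewrite inE jr orbT.
by rewrite !big_seq; apply: eq_bigr => j jr; rewrite Ei.
Qed.

Definition count_events (Omega : Type) (T : nat -> set Omega) (k : nat)
    (w : Omega) : nat := \sum_(j < k) `[< T j w >].

Lemma count_events_le (Omega : Type) (T : nat -> set Omega) k w :
  (count_events T k w <= k)%N.
Proof.
rewrite -[leqRHS]card_ord -sum1_card; apply: leq_sum => j _; exact: leq_b1.
Qed.

Lemma count_eventsS (Omega : Type) (T : nat -> set Omega) k :
  forall j, (count_events T k.+1) @^-1` [set j] =
    ((count_events T k) @^-1` [set j] `\` T k) `|`
    (if j is i.+1 then (count_events T k) @^-1` [set i] `&` T k else set0).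
Proof.
move=> j; apply/seteqP; split => w; rewrite /count_events /= big_ord_recr /=.
  case: asboolP => Tw; rewrite ?(addn0, addn1) => <-; first by right.
  by left.
case=> [[->]|]; first by case: asboolP; rewrite ?addn0.
by case: j => // j [->]; case: asboolP; rewrite ?addn1.
Qed.

Lemma measurable_count_events (disp : measure_display)
    (Omega : measurableType disp) (T : nat -> set Omega) k j :
  (forall i, (i < k)%N -> measurable (T i)) ->
  measurable (count_events T k @^-1` [set j]).
Proof.
elim: k j => [|k IH] j mT.
  have -> : count_events T 0 @^-1` [set j] = if j == 0%N then setT else set0.
    apply/seteqP; split => w; rewrite /count_events /= big_ord0; first by move=> <-.
    by case: eqP.
  by case: ifP.
have mC i : measurable (count_events T k @^-1` [set i]).
  by apply: IH => i' /ltnW; exact: mT.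
rewrite count_eventsS; apply: measurableU.
  by apply: measurableD => //; exact: mT.
by case: j => // j; apply: measurableI => //; exact: mT.
Qed.

(* The moment generating function [\sum_j q ^+ j * P (count = j)], with
   [q = 1 - delta], decreases by a factor [1 - delta * p] at each step. *)
Lemma chernoff_lower_tail (R : realType) (disp : measure_display)
    (Omega : measurableType disp) (P : probability Omega R)
    (T : nat -> set Omega) (N : nat) (p delta : R) :
  0 <= p <= 1 -> 0 <= delta < 1 ->
  (forall k, (k < N)%N -> measurable (T k)) ->
  (forall k j, (k < N)%N ->
     p * fine (P (count_events T k @^-1` [set j]))
     <= fine (P (count_events T k @^-1` [set j] `&` T k))) ->
  fine (P [set w | (count_events T N w)%:R <= (1 - delta) * (p * N%:R)])
    <= expR (- (delta ^+ 2 / 2 * p * N%:R)).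
Proof.
move=> /andP[p0 p1] /andP[d0 d1] mT pT.
pose q := 1 - delta; have q0 : 0 < q by rewrite /q; lra.
pose C k j := count_events T k @^-1` [set j].
pose G k := \sum_(j < k.+1) q ^+ j * fine (P (C k j)).
have mC k j : (k <= N)%N -> measurable (C k j).
  by move=> kN; apply: measurable_count_events => i ik; apply: mT; lia.
have C0 k : C k k.+1 = set0.
  rewrite -subset0 => w /= H; have := count_events_le T k w.
  by rewrite H ltnn.
have GS k : (k < N)%N -> G k.+1 <= (1 - delta * p) * G k.
  move=> kN; have mk j := mC k j (ltnW kN).
  have E j : fine (P (C k.+1 j)) = fine (P (C k j)) - fine (P (C k j `&` T k)) +
      (if j is i.+1 then fine (P (C k i `&` T k)) else 0).
    rewrite /C count_eventsS; case: j => [|j].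
      rewrite setU0 (pr_split P (mk 0%N) (mT _ kN)) /C; ring.
    rewrite prU.
    - by rewrite (pr_split P (mk j.+1) (mT _ kN)) /C; ring.
    - by apply: measurableD; [exact: mk|exact: mT].
    - by apply: measurableI; [exact: mk|exact: mT].
    - by rewrite setDE setIACA setICl setI0.
  rewrite /G (eq_bigr (fun j : 'I_k.+2 =>
      q ^+ j * (fine (P (C k j)) - fine (P (C k j `&` T k))) +
      q ^+ j * (if j : nat is i.+1 then fine (P (C k i `&` T k)) else 0))); last first.
    by move=> j _; rewrite E mulrDr.
  rewrite big_split /= big_ord_recr /= C0 set0I measure0 subrr mulr0 addr0.
  rewrite [X in _ + X]big_ord_recl /= mulr0 add0r mulr_sumr -big_split /=.
  apply: ler_sum => j _; rewrite exprS.
  have := pT k j kN; rewrite -/(C k j) => H.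
  (* Termwise, the new sum contributes [q^j (P(C) - delta P(C and T))], and the conditional lower
     bound turns this into at most [q^j (1 - delta p) P(C)]. *)
  have : 0 <= q ^+ j * delta * (fine (P (C k j `&` T k)) - p * fine (P (C k j))).
    by rewrite mulr_ge0 ?subr_ge0// mulr_ge0 ?exprn_ge0// ltW.
  by move: (q ^+ j) => z; rewrite /q; lra.
have Gk k : (k <= N)%N -> G k <= (1 - delta * p) ^+ k.
  elim: k => [_|k IH kN].
    rewrite /G big_ord1 /= !expr0 mul1r -lee_fin fineK ?fin_num_measure //; last exact: mC.
    by apply: probability_le1; exact: mC.
  apply: le_trans (GS _ kN) _; rewrite exprS ler_wpM2l ?IH ?(ltnW kN)//.
  by rewrite subr_ge0; nra.
set m := (1 - delta) * (p * N%:R); set A := [set w | _].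
have AC (j : nat) : A `&` C N j = if j%:R <= m then C N j else set0.
  apply/seteqP; split => w /=; first by case=> + <-; rewrite /A /= => ->.
  by case: ifP => // H Cw; split => //; rewrite /A /= Cw.
have mAC (j : nat) : measurable (A `&` C N j).
  by rewrite AC; case: ifP => // _; exact: mC.
have -> : fine (P A) = \sum_(j < N.+1) fine (P (A `&` C N j)).
  rewrite (pr_preimage_sum P (g := count_events T N) (r := iota 0 N.+1)).
  - by rewrite -[N.+1]/(N.+1 - 0)%N -/(index_iota 0 N.+1) big_mkord.
  - by move=> i _; exact: mAC.
  - exact: iota_uniq.
  - by move=> w _; rewrite mem_iota add0n ltnS count_events_le.
(* Markov's inequality: on the tail event [j <= m], the weight [q^(j - m)] is at least 1 because
   [q <= 1]. *)
apply: (@le_trans _ _ (expR (- (m * ln q)) * G N)).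
  rewrite /G mulr_sumr; apply: ler_sum => j _; rewrite mulrA AC.
  case: ifP => [jm|_]; last first.
    by rewrite measure0 mulr_ge0 ?pr_ge0// mulr_ge0 ?exprn_ge0 ?expR_ge0 ?ltW.
  rewrite ler_peMl ?pr_ge0//.
  have -> : q ^+ j = expR (j%:R * ln q) by rewrite expRM_natl lnK.
  have jm0 : j%:R - m <= 0 by rewrite subr_le0.
  have lq0 : ln q <= 0 by apply: ln_le0; rewrite /q; lra.
  have := mulr_le0 jm0 lq0.
  by rewrite -expRD -expR0 ler_expR mulrBl addrC.
apply: (@le_trans _ _ (expR (- (m * ln q)) * expR (- (delta * p * N%:R)))).
  rewrite ler_wpM2l ?expR_ge0//; apply: le_trans (Gk _ (leqnn _)) _.
  rewrite -[in leRHS]mulNr expRM_natr lerXn2r ?nnegrE ?expR_ge0//; first by nra.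
  exact: expR_ge1Dx.
rewrite -expRD ler_expR.
(* With [m = q p N], the exponent is [- p N (q ln q + delta)], and
   [q ln q + delta >= delta^2 / 2]. *)
have := chernoff_exponent (x := delta); rewrite d0 d1 => /(_ isT) H.
have pN : 0 <= p * N%:R by rewrite mulr_ge0.
have := ler_wpM2r pN H; rewrite /m /q; lra.
Qed.

(** * Measurability *)

Lemma random_matrix_mulmx (R : realType) (disp : measure_display)
    (Omega : measurableType disp) m n p
    (X : Omega -> 'M[R]_(m, n)) (Y : Omega -> 'M[R]_(n, p)) :
  random_matrix X -> random_matrix Y -> random_matrix (fun w => X w *m Y w).
Proof.
move=> mX mY i j; under eq_fun do rewrite mxE.
by apply: measurable_sum => k; exact: measurable_funM.
Qed.

Lemma random_matrix_add (R : realType) (disp : measure_display)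
    (Omega : measurableType disp) m n (X Y : Omega -> 'M[R]_(m, n)) :
  random_matrix X -> random_matrix Y -> random_matrix (fun w => X w + Y w).
Proof.
move=> mX mY i j; under eq_fun do rewrite mxE; exact: measurable_funD.
Qed.

Lemma random_matrix_tr (R : realType) (disp : measure_display)
    (Omega : measurableType disp) m n (X : Omega -> 'M[R]_(m, n)) :
  random_matrix X -> random_matrix (fun w => (X w)^T).
Proof. by move=> mX i j; under eq_fun do rewrite mxE; exact: mX. Qed.

Lemma random_matrix_cst (R : realType) (disp : measure_display)
    (Omega : measurableType disp) m n (A : 'M[R]_(m, n)) :
  random_matrix (fun _ : Omega => A).
Proof. by move=> i j; exact: measurable_cst. Qed.

Lemma measurable_dot (R : realType) (disp : measure_display)
    (Omega : measurableType disp) n (X Y : Omega -> 'cV[R]_n) :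
  random_matrix X -> random_matrix Y ->
  measurable_fun setT (fun w => dot (X w) (Y w)).
Proof.
by move=> mX mY; apply: measurable_sum => k; exact: measurable_funM.
Qed.

Lemma measurable_matrix_eq (R : realType) (disp : measure_display)
    (Omega : measurableType disp) m n (X : Omega -> 'M[R]_(m, n)) M :
  random_matrix X -> measurable (X @^-1` [set M]).
Proof.
move=> mX; have -> : X @^-1` [set M] =
    \bigcap_(ij in [set: 'I_m * 'I_n])
      (setT `&` (fun w => X w ij.1 ij.2) @^-1` [set M ij.1 ij.2]).
  apply/seteqP; split => w /=; first by move=> <- ij _; split.
  by move=> H; apply/matrixP => i j; have [] := H (i, j) I.
by apply: fin_bigcap_measurable => // -[i j] _ /=; exact: mX.
Qed.

(** An open set is the union of the boxes with rational centre and radius [1 / (k + 1)] that it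
    contains. There are countably many, and each pulls back to a finite intersection of entry
    events. *)
Lemma measurable_open_preimage_mx (R : realType) (disp : measure_display)
    (Omega : measurableType disp) m n (X : Omega -> 'M[R]_(m, n))
    (U : set 'M[R]_(m, n)) :
  random_matrix X -> open U -> measurable (X @^-1` U).
Proof.
move=> mX oU.
pose box (q : 'M[rat]_(m, n) * nat) : set Omega :=
  if `[< forall M : 'M[R]_(m, n),
    (forall i j, `|M i j - ratr (q.1 i j)| < q.2.+1%:R^-1) -> U M >]
  then \bigcap_(ij in [set: 'I_m * 'I_n])
    (setT `&` (fun w => X w ij.1 ij.2) @^-1`
      (ball (ratr (q.1 ij.1 ij.2) : R) q.2.+1%:R^-1)) else set0.
have -> : X @^-1` U = \bigcup_q box q.
  apply/seteqP; split => w /=; last first.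
    move=> [q _]; rewrite /box; case: asboolP => // H qw; apply: H => i j.
    by have [_ /=] := qw (i, j) I; rewrite /ball /= distrC.
  move=> UX; have /nbhs_ballP[e /= e0 eU] : nbhs (X w) U by exact: open_nbhs_nbhs.
  (* Twice the mesh fits in [e]: one [r] for approximating [X w] by a rational matrix, one for the
     box around that matrix. *)
  pose k := Num.truncn (2 / e); pose r : R := k.+1%:R^-1.
  have r0 : 0 < r by rewrite invr_gt0.
  have re : r + r <= e.
    have : 2 / e < k.+1%:R by rewrite truncnS_gt.
    rewrite ltr_pdivrMr // -ltr_pdivrMl // => H.
    by rewrite -mulr2n -[leLHS]mulr_natl mulrC; exact: ltW.
  have [q qX] : exists q : 'M[rat]_(m, n), forall i j, `|X w i j - ratr (q i j)| < r.
    have /choice[q Hq] : forall ij : 'I_m * 'I_n, exists q : rat,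
        `|X w ij.1 ij.2 - ratr q| < r.
      move=> [i j] /=.
      have /rat_in_itvoo[q] : X w i j < X w i j + r by rewrite ltrDl.
      rewrite in_itv /= => /andP[q1 q2]; exists q.
      by rewrite ltr_norml; apply/andP; split; lra.
    exists (\matrix_(i, j) q (i, j)) => i j; rewrite mxE; exact: (Hq (i, j)).
  exists (q, k) => //; rewrite /box asboolT /=; last first.
    move=> M MX; apply: eU; split => // i j; apply: (@lt_le_trans _ _ (r + r)) => //.
    rewrite -(subrKA (ratr (q i j))); apply: le_lt_trans (ler_normD _ _) _.
    by apply: ltrD => //; rewrite distrC; exact: MX.
  by move=> [i j] _ /=; split => //; rewrite /ball /= distrC; exact: qX.
apply: countable_bigcupT_measurable => // q.
rewrite /box; case: asboolP => // _.
apply: fin_bigcap_measurable => // -[i j] _ /=.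
by apply: mX => //; exact: measurable_ball.
Qed.

Lemma measurable_continuous_mx (R : realType) (disp : measure_display)
    (Omega : measurableType disp) m n (X : Omega -> 'M[R]_(m, n))
    (h : 'M[R]_(m, n) -> R) :
  random_matrix X -> continuous h -> measurable_fun setT (fun w => h (X w)).
Proof.
move=> mX ch; apply: (measurability _ (RGenOpens.measurableE R)) => //.
move=> _ [_ [a [b ->] <-]]; rewrite setTI.
apply: (measurable_open_preimage_mx (U := h @^-1` `]a, b[)) => //.
by move/continuousP : ch; apply; exact: interval_open.
Qed.

Lemma random_matrix_gradient (R : realType) (disp : measure_display)
    (Omega : measurableType disp) d (f : 'cV[R]_d -> R) (X : Omega -> 'cV[R]_d) :
  continuous (gradient f) -> random_matrix X ->
  random_matrix (fun w => gradient f (X w)).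
Proof.
move=> cg mX i j; apply: (measurable_continuous_mx (h := fun y => gradient f y i j)) => //.
move=> y; apply: (@continuous_comp _ _ _ (gradient f) (fun M => M i j)).
  exact: cg.
exact: coord_continuous.
Qed.

Lemma trust_region_step_measurable (R : realType) (disp : measure_display)
    (Omega : measurableType disp) l d (f : 'cV[R]_d -> R)
    gamma1 gamma2 theta alpha_max Bmax C7
    (S : Omega -> 'M[R]_(l, d)) (B : Omega -> 'M[R]_d) (shat : Omega -> 'cV[R]_l)
    (x x' : Omega -> 'cV[R]_d) (alpha alpha' : Omega -> R) :
  continuously_differentiable f ->
  random_matrix S -> random_matrix B -> random_matrix shat -> random_matrix x ->
  (forall w, trust_region_step f gamma1 gamma2 theta alpha_max Bmax C7
     (S w) (B w) (shat w) (x w) (alpha w) (x' w) (alpha' w)) ->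
  random_matrix x'.
Proof.
move=> [df cg] mS mB ms mx st.
have cf : continuous f by move=> y; apply: differentiable_continuous; exact: df.
have mz := random_matrix_add mx (random_matrix_mulmx (random_matrix_tr mS) ms).
have mfz := measurable_continuous_mx mz cf.
have mfx := measurable_continuous_mx mx cf.
have mSg := random_matrix_mulmx mS (random_matrix_gradient cg mx).
have mmod (s : Omega -> 'cV[R]_l) : random_matrix s ->
    measurable_fun setT (fun w => reduced_model f (x w) (S w) (B w) (s w)).
  move=> mrs; apply: measurable_funD.
    by apply: measurable_funD => //; exact: measurable_dot.
  apply: measurable_funM; first exact: measurable_cst.
  apply: measurable_dot => //; apply: random_matrix_mulmx => //.
  apply: random_matrix_mulmx; last exact: random_matrix_tr.
  exact: random_matrix_mulmx.
move=> i j; pose test w := theta * (reduced_model f (x w) (S w) (B w) 0 -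
  reduced_model f (x w) (S w) (B w) (shat w))
  <= f (x w) - f (x w + (S w)^T *m shat w).
have -> : (fun w => x' w i j) =
    (fun w => if test w then (x w + (S w)^T *m shat w) i j else x w i j).
  apply/funext => w; case: (st w) => _ _ _; rewrite -/(test w).
  by case: (test w) => -[->].
apply: measurable_fun_ifT; [|exact: mz|exact: mx].
apply: measurable_fun_ler.
  apply: measurable_funM; first exact: measurable_cst.
  apply: measurable_funB; apply: mmod => //; exact: random_matrix_cst.
exact: measurable_funB.
Qed.

(** * Conditioning on the history *)

Lemma big_option_Some (R : zmodType) (I : finType) (F : option I -> R) :
  F None = 0 -> \sum_o F o = \sum_i F (Some i).
Proof.
move=> F0; rewrite (bigD1 None) //= F0 add0r.
rewrite (reindex_omap Some id) /=; last by case.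
by apply: eq_bigl => i; rewrite eqxx.
Qed.

(* Conditioning on the finitely many possible sets [pat w] of good values makes
   the choice [Z] independent of which values are good. *)
Lemma independent_choice_lower_bound (R : realType) (disp : measure_display)
    (Omega : measurableType disp) (P : probability Omega R) (I : finType)
    (Z : Omega -> option I) (good : I -> set Omega) (A : set Omega) (p : R) :
  measurable A -> (forall i, measurable (good i)) ->
  (forall i, measurable (Z @^-1` [set Some i])) ->
  (forall i, P ((A `&` good i) `&` Z @^-1` [set Some i]) =
     (P (A `&` good i) * P (Z @^-1` [set Some i]))%E) ->
  (forall w, p <= \sum_(i | `[< good i w >]) fine (P (Z @^-1` [set Some i]))) ->
  p * fine (P A) <=
    fine (P (A `&` [set w | if Z w is Some i then good i w else False])).
Proof.
move=> mA mgood mZ ind pgood.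
(* The pattern takes finitely many values, so summing over it replaces a conditional expectation
   given the history. *)
pose pat (w : Omega) : {ffun I -> bool} := [ffun i => `[< good i w >]].
have mpat q : measurable (pat @^-1` [set q]).
  have -> : pat @^-1` [set q] =
      \bigcap_(i in [set: I]) (if q i then good i else ~` good i).
    apply/seteqP; split => w /=.
      by move=> <- i _; rewrite ffunE; case: asboolP.
    move=> H; apply/ffunP => i; rewrite ffunE; have := H i Logic.I.
    by case: (q i) => /= [?|?]; [exact: asboolT|exact: asboolF].
  apply: fin_bigcap_measurable => // i _; case: (q i) => //; exact: measurableC.
pose pi i := fine (P (Z @^-1` [set Some i])).
have split_pat B : measurable B ->
    fine (P B) = \sum_q fine (P (B `&` pat @^-1` [set q])).
  move=> mB; rewrite [LHS](pr_preimage_sum P (g := pat) (r := enum {ffun I -> bool})).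
  - by rewrite big_enum.
  - by move=> q _; exact: measurableI.
  - exact: enum_uniq.
  - by move=> w _; rewrite mem_enum.
set T := [set w | _].
have TZ o : A `&` T `&` Z @^-1` [set o] =
    if o is Some i then (A `&` good i) `&` Z @^-1` [set Some i] else set0.
  apply/seteqP; split => w /=; rewrite /T /=.
    by move=> [[Aw Tw] Zw]; move: Tw; rewrite Zw; case: o Zw.
  by case: o => // i [[Aw gw] Zw]; rewrite Zw.
have -> : fine (P (A `&` T)) = \sum_i fine (P (A `&` good i)) * pi i.
  rewrite (pr_preimage_sum P (g := Z) (r := enum {: option I})).
  - rewrite big_enum big_option_Some ?TZ ?measure0 //; apply: eq_bigr => i _.
    by rewrite TZ ind fineM ?fin_num_measure //; exact: measurableI.
  - move=> o _; rewrite TZ; case: o => // i; apply: measurableI => //.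
    exact: measurableI.
  - exact: enum_uniq.
  - by move=> w _; rewrite mem_enum.
have -> : \sum_i fine (P (A `&` good i)) * pi i =
    \sum_(q : {ffun I -> bool}) fine (P (A `&` pat @^-1` [set q])) * \sum_(i | q i) pi i.
  have mAg i : measurable (A `&` good i) by exact: measurableI.
  under eq_bigr => i _ do rewrite (split_pat _ (mAg i)) mulr_suml.
  rewrite exchange_big; apply: eq_bigr => q _.
  rewrite mulr_sumr [RHS]big_mkcond; apply: eq_bigr => i _ /=.
  have -> : A `&` good i `&` pat @^-1` [set q] =
      if q i then A `&` pat @^-1` [set q] else set0.
    case: ifP => qi; apply/seteqP; split => w //=.
    - by move=> [[]].
    - move=> [Aw qw]; do 2 split => //; move: qi; rewrite -qw ffunE.
      by move/asboolP.
    - by move=> [[_ gw] qw]; move: qi; rewrite -qw ffunE asboolT.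
  by case: ifP => // _; rewrite measure0 mul0r.
rewrite (split_pat A mA) mulr_sumr; apply: ler_sum => q _.
(* The pointwise hypothesis needs a sample point with pattern [q]: a nonempty cell supplies one, and
   an empty cell contributes 0. *)
have [->|/set0P[w [_ qw]]] := eqVneq (A `&` pat @^-1` [set q]) set0.
  by rewrite measure0 mulr0 mul0r.
rewrite mulrC ler_wpM2l ?pr_ge0 //; apply: le_trans (pgood w) _.
by rewrite le_eqVlt; apply/orP; left; apply/eqP/eq_bigl => i; rewrite -qw ffunE.
Qed.

(** Finite support of the hashing law. Duplicates are removed because samples differing only in the
    chosen copies give the same matrix. *)
Definition hashing_matrices (R : realType) (l d : nat) : seq 'M[R]_(l, d) :=
  undup [seq hashing_mx R w | w <- enum (@hashing_samples l d)].

(** Links the embedding result, stated by counting samples, with the law of [S k], known through its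
    point masses: group the samples by the matrix they produce. *)
Lemma stable_hashing_prob_sum (R : realType) (l d : nat) (E : pred 'M[R]_(l, d)) :
  stable_hashing_prob E =
  \sum_(M : seq_sub (hashing_matrices R l d) | E (val M))
    stable_hashing_prob (pred1 (val M)).
Proof.
rewrite /stable_hashing_prob -mulr_suml -natr_sum; congr (_%:R / _).
pose h w : option (seq_sub (hashing_matrices R l d)) := insub (hashing_mx R w).
rewrite -sum1_card (partition_big h xpredT) //=.
rewrite (bigD1 None) //= big1 ?add0n; last first.
  move=> w /andP[/andP[hw _]]; rewrite /h; case: insubP => // /negP[].
  rewrite mem_undup; apply/mapP; exists w => //.
  by rewrite mem_enum.
rewrite (reindex_omap Some id) /=; last by case.
rewrite [RHS]big_mkcond [LHS]big_mkcond; apply: eq_bigr => M _ /=.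
rewrite eqxx.
have hM w : (h w == Some M) = (hashing_mx R w == val M).
  apply/eqP/eqP; rewrite /h; first by case: insubP => // M' _ <- [->].
  by move=> ->; rewrite valK.
case: ifP => EM.
  rewrite -sum1_card; apply: eq_bigl => w; rewrite !inE hM.
  by case: eqP => [->|]; rewrite ?andbF ?andbT // EM andbT.
rewrite big1 // => w /andP[]; rewrite hM => + /eqP Mw.
by rewrite inE Mw EM andbF.
Qed.

(** * Counting true iterations *)

(** The minimum is at most [1 / gamma2 = gamma1 ^+ c < 1], so its logarithm is positive and the
    ceiling is a natural number. The two bounds are those of a ceiling, reversed by
    [ln gamma1 < 0]. *)
Lemma tau_alpha_spec (R : realType) (l d c : nat)
    (gamma1 gamma2 theta Bmax C7 L eps epsS alpha0 : R) :
  0 < gamma1 < 1 -> gamma2 = gamma1 ^- c -> (0 < c)%N -> 0 < alpha0 ->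
  0 < alpha_low l d theta Bmax C7 L eps epsS ->
  exists t : nat,
  [/\ tau_alpha l d gamma1 gamma2 theta Bmax C7 L eps epsS alpha0 = t%:Z,
    gamma1 ^+ t <= Num.min (alpha_low l d theta Bmax C7 L eps epsS / alpha0)
                           (1 / gamma2) &
    gamma1 * Num.min (alpha_low l d theta Bmax C7 L eps epsS / alpha0)
                           (1 / gamma2) <= gamma1 ^+ t].
Proof.
move=> /andP[g0 g1] -> c0 a0 al0; rewrite /tau_alpha div1r invrK.
set m := Num.min _ _.
have m0 : 0 < m by rewrite lt_min divr_gt0 // exprn_gt0.
have lng : ln gamma1 < 0 by rewrite ln_lt0 // g0.
have m1 : m < 1.
  apply: (@le_lt_trans _ _ (gamma1 ^+ c)); first by rewrite ge_min lexx orbT.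
  by rewrite exprn_ilt1 ?(ltW g0)// -lt0n.
have lnm : ln m < 0 by rewrite ln_lt0 // m0.
have log0 : 0 < log_base gamma1 m by rewrite /log_base nmulr_rgt0 // invr_lt0.
have : 0 < Num.ceil (log_base gamma1 m) by rewrite ceil_gt0.
case Et : (Num.ceil _) => [t|//] _; exists t; split => //.
- have := ceil_ge (log_base gamma1 m); rewrite Et /log_base.
  rewrite ler_ndivrMr // => H.
  rewrite -ler_ln ?posrE ?exprn_gt0 // lnXn // -mulr_natl.
  exact: H.
- have : t%:R - 1 < log_base gamma1 m.
    have := ceil_itv (log_base gamma1 m); rewrite Et => /andP[+ _].
    by rewrite intrD.
  rewrite /log_base ltr_ndivlMr // => H.
  rewrite -ler_ln ?posrE ?mulr_gt0 ?exprn_gt0 // lnXn // lnM ?posrE // -mulr_natl.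
  by rewrite mulrBl in H; lra.
Qed.

Fixpoint radius_exponent (c p : nat) (U : nat -> bool) (k : nat) : nat :=
  if k is j.+1 then
    if U j then (radius_exponent c p U j - c)%N else (radius_exponent c p U j).+1
  else p.

(** Deterministic statement along one sample path. It applies [count_true_iterations] at level
    [E = p + t], with [t] the value of [tau_alpha]: the exponent from which the radius is at most
    [alpha_low]. *)
Lemma trust_region_true_count (R : realType) (l d : nat)
    (f : 'cV[R]_d -> R) (L fstar : R)
    (gamma1 gamma2 theta alpha_max Bmax C7 alpha0 : R) (c p : nat) (x0 : 'cV[R]_d)
    (eps epsS : R) (N : nat) (good : nat -> bool)
    (S : nat -> 'M[R]_(l, d)) (B : nat -> 'M[R]_d) (shat : nat -> 'cV[R]_l)
    (x : nat -> 'cV[R]_d) (alpha : nat -> R) :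
  (0 < l)%N -> (l < d)%N ->
  (forall y, differentiable f y) -> lipschitz_gradient f L ->
  (forall y, fstar <= f y) ->
  0 < gamma1 < 1 -> (0 < c)%N -> gamma2 = gamma1 ^- c -> 0 < theta < 1 ->
  0 < alpha_max -> 0 < Bmax -> 0 < C7 -> alpha0 = alpha_max * gamma1 ^+ p ->
  0 < eps -> epsS < 1 -> x 0%N = x0 -> alpha 0%N = alpha0 ->
  (forall k, (k < N)%N -> trust_region_step f gamma1 gamma2 theta alpha_max Bmax C7
     (S k) (B k) (shat k) (x k) (alpha k) (x k.+1) (alpha k.+1)) ->
  (forall k, (k < N)%N -> eps < norm2 (gradient f (x k))) ->
  (forall k, good k -> S k \in hashing_matrices R l d /\
     (1 - epsS) * norm2 (gradient f (x k)) ^+ 2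
       <= norm2 (S k *m gradient f (x k)) ^+ 2) ->
  (\sum_(k < N) good k)%:R <=
    (f x0 - fstar) / h_value l d c gamma1 gamma2 theta Bmax C7 L eps epsS alpha0
    + c%:R / (c%:R + 1) * N%:R
    + (tau_alpha l d gamma1 gamma2 theta Bmax C7 L eps epsS alpha0)%:~R / (1 + c%:R).
Proof.
move=> l0 ld df fL fmin g01 c0 g2E th01 am0 B0 C70 a0E eps0 epsS1 x0E al0E st geps goodP.
have d0 : (0 < d)%N := ltn_trans l0 ld.
have L0 := lipschitz_gradient_ge0 d0 fL.
have /andP[g0 g1] := g01; have /andP[th0 th1] := th01.
have K0 : 0 < (ceil_div d l)%:R :> R.
  by rewrite ltr0n addn_gt0 divn_gt0 // (ltnW ld).
(* Lower bound on the sketched gradient at a true iteration that is not yet [eps]-stationary. *)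
pose gS := Num.sqrt (1 - epsS) * eps.
have gS0 : 0 < gS by rewrite mulr_gt0 // sqrtr_gt0 subr_gt0.
have gS2 : gS ^+ 2 = (1 - epsS) * eps ^+ 2.
  by rewrite exprMn sqr_sqrtr // subr_ge0 ltW.
have LB0 : 0 < (L + 1 / 2 * Bmax) * (ceil_div d l)%:R.
  by rewrite mulr_gt0 //; lra.
have cv0 : 0 < curvature_min l d theta Bmax C7 L.
  by rewrite lt_min !divr_gt0 // mulr_gt0 // subr_gt0.
have a00 : 0 < alpha0 by rewrite a0E mulr_gt0 // exprn_gt0.
have alow0 : 0 < alpha_low l d theta Bmax C7 L eps epsS by rewrite mulr_gt0.
have [t [-> tle tge]] := tau_alpha_spec g01 g2E c0 a00 alow0.
have g20 : 0 < gamma2 by rewrite g2E invr_gt0 exprn_gt0.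
set h := h_value _ _ _ _ _ _ _ _ _ _ _ _.
have h0 : 0 < h.
  rewrite /h /h_value !mulr_gt0 ?exprn_gt0 ?subr_gt0 //.
  by rewrite lt_min cv0 divr_gt0 // mulr_gt0.
pose U k := f (x k) - f (x k + (S k)^T *m shat k) >=
  theta * (reduced_model f (x k) (S k) (B k) 0 - reduced_model f (x k) (S k) (B k) (shat k)).
pose e := radius_exponent c p U.
have aE k : (k <= N)%N -> alpha k = alpha_max * gamma1 ^+ e k.
  elim: k => [_|k IH kN]; first by rewrite al0E a0E.
  have := st k kN; rewrite g2E => stk.
  by rewrite (trust_region_step_radius g01 am0 stk (IH (ltnW kN))).
have agt0 k : (k <= N)%N -> 0 < alpha k.
  by move=> kN; rewrite aE // mulr_gt0 // exprn_gt0.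
have goodS k : (k < N)%N -> good k -> gS <= norm2 (S k *m gradient f (x k)).
  move=> kN /goodP[_ H].
  rewrite -ler_sqr ?nnegrE ?norm2_ge0 ?(ltW gS0)// gS2; apply: le_trans H.
  rewrite ler_wpM2l ?subr_ge0 ?(ltW epsS1)// ler_sqr ?nnegrE ?norm2_ge0 ?(ltW eps0)//.
  by rewrite ltW // geps.
have aElow k : (k <= N)%N -> (p + t <= e k)%N ->
    alpha k <= alpha_low l d theta Bmax C7 L eps epsS.
  move=> kN Ek; rewrite aE //.
  apply: (@le_trans _ _ (alpha0 * gamma1 ^+ t)).
    rewrite a0E -mulrA -exprD ler_wpM2l ?(ltW am0)//.
    by apply: ler_wiXn2l => //; exact: ltW.
  move: tle; rewrite le_min => /andP[+ _].
  by rewrite ler_pdivlMr // mulrC.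
have TU k : (k < N)%N -> good k -> (p + t <= e k)%N -> U k.
  move=> kN gk Ek; have [+ _] := goodP _ gk.
  rewrite mem_undup => /mapP[w]; rewrite mem_enum => hw SE.
  have := aElow _ (ltnW kN) Ek; rewrite /alpha_low -/gS => alow.
  apply: (small_radius_sufficient_decrease d0 df fL (ltW K0) _ (ltW th1) C70 B0
    (ltW gS0) (goodS _ kN gk) (ltW (agt0 _ (ltnW kN))) _ _ (st k kN)).
  - by move=> s; rewrite SE; exact: hashing_mx_tr_norm.
  - rewrite -ler_pdivlMr // -[leRHS]mulrA; apply: le_trans alow _.
    by rewrite ler_wpM2l ?(ltW gS0)// ge_min lexx.
  - apply: le_trans alow _; rewrite ler_wpM2l ?(ltW gS0)// ge_min.
    by rewrite [1 / Bmax]div1r lexx orbT.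
have hdec k : (k < N)%N -> good k -> U k -> (e k <= p + t + c)%N ->
    h <= f (x k) - f (x k.+1).
  move=> kN gk Uk Ek.
  have ak0 := ltW (agt0 _ (ltnW kN)).
  have dec := reduced_model_decrease C70 (ltW gS0) (goodS _ kN gk) ak0 (ltW B0) (st k kN).
  have -> : x k.+1 = x k + (S k)^T *m shat k.
    by case: (st k kN) => _ _ _; rewrite ifT // => -[].
  apply: le_trans Uk; apply: le_trans (ler_wpM2l (ltW th0) dec).
  set mm := Num.min (curvature_min l d theta Bmax C7 L) (alpha0 / (gS * gamma2)).
  have mm0 : 0 < mm by rewrite lt_min cv0 divr_gt0 // mulr_gt0.
  have -> : h = theta * (C7 * gS * (gS * (gamma1 ^+ c.+1 * mm))).
    rewrite /h /h_value -/gS -/mm.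
    transitivity (theta * C7 * gS ^+ 2 * gamma1 ^+ c.+1 * mm); last by ring.
    by rewrite gS2; ring.
  rewrite ler_wpM2l ?(ltW th0)// ler_wpM2l //; first exact/ltW/mulr_gt0.
  (* For the radius, the exponent bound [p + t + c] costs [gamma1 ^+ c] and the rounding in
     [tau_alpha] one further [gamma1]; this is the factor [gamma1 ^+ c.+1] of [h]. *)
  rewrite le_min; apply/andP; split.
    rewrite (aE _ (ltnW kN)); apply: (@le_trans _ _ (alpha0 * gamma1 ^+ t * gamma1 ^+ c)).
      have -> : gS * (gamma1 ^+ c.+1 * mm) = gS * (gamma1 * mm) * gamma1 ^+ c.
        by rewrite exprS; ring.
      rewrite ler_wpM2r ?exprn_ge0 ?(ltW g0)//.
      apply: (@le_trans _ _ (alpha0 * (gamma1 *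
        Num.min (alpha_low l d theta Bmax C7 L eps epsS / alpha0) (1 / gamma2)))).
        rewrite mulrCA [leRHS]mulrCA ler_wpM2l ?(ltW g0)//.
        rewrite [leRHS]minr_pMr ?(ltW a00)// le_min; apply/andP; split.
          rewrite [leRHS]mulrC divfK ?gt_eqF// ler_wpM2l ?(ltW gS0)//.
          by rewrite ge_min lexx.
        have -> : alpha0 * (1 / gamma2) = gS * (alpha0 / (gS * gamma2)).
          by field; rewrite !gt_eqF.
        by rewrite ler_wpM2l ?(ltW gS0)// ge_min lexx orbT.
      by rewrite ler_wpM2l ?(ltW a00).
    have -> : alpha0 * gamma1 ^+ t * gamma1 ^+ c = alpha_max * gamma1 ^+ (p + t + c).
      by rewrite a0E !exprD !mulrA.
    rewrite ler_wpM2l ?(ltW am0)//.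
    by apply: ler_wiXn2l => //; exact: ltW.
  rewrite ler_wpM2l ?(ltW gS0)//.
  apply: (@le_trans _ _ mm).
    by rewrite ler_piMl ?(ltW mm0)// exprn_ile1 ?ltW.
  by rewrite /mm /curvature_min !ge_min [1 / Bmax]div1r lexx !orbT.
have decr k : (k < N)%N -> f (x k.+1) <= f (x k).
  move=> kN; apply: (trust_region_step_le (ltW th0) C70 _ (ltW B0) (st k kN)).
  exact/ltW/agt0/ltnW.
(* Telescoping: each counted step lowers [f] by at least [h], no step raises it, and [f] stays above
   [fstar]. *)
have H1 : (\sum_(k < N) [&& good k, U k & (e k <= p + t + c)%N])%:R * h <= f x0 - fstar.
  apply: (@le_trans _ _ (f x0 - f (x N))); last by rewrite lerD2l lerN2.
  have : forall n, (n <= N)%N ->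
    (\sum_(k < n) [&& good k, U k & (e k <= p + t + c)%N])%:R * h <= f x0 - f (x n).
    elim=> [_|n IH nN]; first by rewrite big_ord0 mul0r x0E subrr.
    rewrite big_ord_recr /= natrD mulrDl.
    have := IH (ltnW nN); have := decr n nN.
    case: (boolP [&& _, _ & _]) => [/and3P[gn Un En]|_] /=; last by lra.
    by have := hdec n nN gn Un En; rewrite mul1r; lra.
  exact.
have H2 := count_true_iterations (c := c) (E := p + t) (T := good) (U := U) (e := e) (N := N) c0
  (leq_addr _ _) (fun k _ => erefl) TU.
move: H1; rewrite -ler_pdivlMr //.
move: H2; rewrite (_ : e 0%N = p) // addKn.
set n1 := (\sum_(k < N) good k)%N; set n2 := (\sum_(k < N) _)%N; set q := _ / h.
rewrite -(ler_nat R) !natrD !natrM => H2 H1.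
have c1 : 0 < c%:R + 1 :> R by rewrite ltr_wpDl.
rewrite -(ler_pM2l c1).
rewrite [1 + _]addrC !mulrDr.
have -> : (c%:R + 1) * (t%:~R / (c%:R + 1)) = t%:R :> R by field; rewrite gt_eqF.
have -> : (c%:R + 1) * (c%:R / (c%:R + 1) * N%:R) = c%:R * N%:R :> R by field; rewrite gt_eqF.
have := ler_wpM2l (ltW c1) H1; lra.
Qed.

(** * The complexity bound *)

(* Requiring [S k w] to be a hashing matrix, which holds almost surely, makes the
   bound on the number of true iterations valid for every [w]. *)
Definition true_iteration (R : realType) (Omega : Type) (l d : nat)
    (f : 'cV[R]_d -> R) (epsS : R) (S : nat -> Omega -> 'M[R]_(l, d))
    (x : nat -> Omega -> 'cV[R]_d) (k : nat) : set Omega :=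
  [set w | S k w \in hashing_matrices R l d /\
     (1 - epsS) * norm2 (gradient f (x k w)) ^+ 2
       <= norm2 (S k w *m gradient f (x k w)) ^+ 2].

(** The measurable space is arbitrary so that the result serves both for [Omega] and for [Omega]
    with the coarser history sigma-algebra. *)
Lemma iterates_measurable (R : realType) (disp : measure_display)
    (Omega : measurableType disp) l d (f : 'cV[R]_d -> R)
    gamma1 gamma2 theta alpha_max Bmax C7 x0
    (S : nat -> Omega -> 'M[R]_(l, d)) (B : nat -> Omega -> 'M[R]_d)
    (shat : nat -> Omega -> 'cV[R]_l) (x : nat -> Omega -> 'cV[R]_d)
    (alpha : nat -> Omega -> R) (n : nat) :
  continuously_differentiable f -> (forall w, x 0%N w = x0) ->
  (forall k, (k < n)%N ->
     [/\ random_matrix (S k), random_matrix (B k) & random_matrix (shat k)]) ->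
  (forall k w, (k < n)%N -> trust_region_step f gamma1 gamma2 theta alpha_max Bmax C7
     (S k w) (B k w) (shat k w) (x k w) (alpha k w) (x k.+1 w) (alpha k.+1 w)) ->
  forall k, (k <= n)%N -> random_matrix (x k).
Proof.
move=> hf x0E mSBs st; elim=> [_|k IH kn].
  by rewrite (_ : x 0%N = cst x0); [exact: random_matrix_cst|exact/funext].
have [mS mB ms] := mSBs k kn.
apply: (trust_region_step_measurable hf mS mB ms (IH (ltnW kn))) => w.
exact: st.
Qed.

Lemma measurable_embedded (R : realType) (disp : measure_display)
    (Omega : measurableType disp) l d (f : 'cV[R]_d -> R) (epsS : R)
    (S : Omega -> 'M[R]_(l, d)) (x : Omega -> 'cV[R]_d) :
  continuous (gradient f) -> random_matrix S -> random_matrix x ->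
  measurable [set w | (1 - epsS) * norm2 (gradient f (x w)) ^+ 2
       <= norm2 (S w *m gradient f (x w)) ^+ 2].
Proof.
move=> cg mS mx; have mg := random_matrix_gradient cg mx.
have mSg := random_matrix_mulmx mS mg.
rewrite (_ : mkset _ = setT `&` [set w | (1 - epsS) *
    dot (gradient f (x w)) (gradient f (x w)) <=
    dot (S w *m gradient f (x w)) (S w *m gradient f (x w))]); last first.
  by rewrite setTI; apply/funext => w; rewrite /= !norm2_sqr.
apply: measurable_fun_le => //; last exact: measurable_dot.
apply: measurable_funM; [exact: measurable_cst|exact: measurable_dot].
Qed.

Lemma measurable_true_iteration (R : realType) (disp : measure_display)
    (Omega : measurableType disp) l d (f : 'cV[R]_d -> R) (epsS : R)
    (S : nat -> Omega -> 'M[R]_(l, d)) (x : nat -> Omega -> 'cV[R]_d) k :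
  continuous (gradient f) -> random_matrix (S k) -> random_matrix (x k) ->
  measurable (true_iteration f epsS S x k).
Proof.
move=> cg mS mx.
suff mSk : measurable [set w | S k w \in hashing_matrices R l d].
  exact: measurableI mSk (measurable_embedded epsS cg mS mx).
rewrite (_ : mkset _ = \big[setU/set0]_(M <- hashing_matrices R l d) (S k @^-1` [set M])).
  by apply: bigsetU_measurable => M _; exact: measurable_matrix_eq.
rewrite -bigcup_seq; apply/seteqP; split => w /=; first by move=> Sw; exists (S k w).
by move=> [M /= ML ->].
Qed.

(** The past count and [x k] are determined by the history, so for each fixed matrix [M] the event
    that [M] embeds the current gradient is independent of [S k = M]. The embedding result then
    bounds the total mass of the good matrices at every sample point. *)
Lemma true_iteration_given_history (R : realType) (disp : measure_display)
    (Omega : measurableType disp) (P : probability Omega R) (l d : nat)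
    (f : 'cV[R]_d -> R) (C3 epsS : R)
    gamma1 gamma2 theta alpha_max Bmax C7 x0 alpha0 (N : nat)
    (S : nat -> Omega -> 'M[R]_(l, d)) (B : nat -> Omega -> 'M[R]_d)
    (shat : nat -> Omega -> 'cV[R]_l)
    (x : nat -> Omega -> 'cV[R]_d) (alpha : nat -> Omega -> R) k i :
  (0 < l)%N -> (l < d)%N -> continuously_differentiable f ->
  hashing_embedding_constant f C3 ->
  0 < epsS < 3 / 4 -> 0 < deltaS_of C3 l epsS < 1 / 2 ->
  random_subspace_trust_region P f (@stable_hashing R disp Omega P l d)
    gamma1 gamma2 theta alpha_max Bmax C7 x0 alpha0 N S B shat x alpha ->
  (k < N)%N ->
  (1 - deltaS_of C3 l epsS) *
    fine (P (count_events (true_iteration f epsS S x) k @^-1` [set i]))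
  <= fine (P (count_events (true_iteration f epsS S x) k @^-1` [set i] `&`
              true_iteration f epsS S x k)).
Proof.
move=> l0 ld hf hembed heps hdel hrun kN; set T := true_iteration f epsS S x.
have [x0E _ hS hind hB hs hst] := hrun; have [_ cg] := hf.
pose G := \bigcup_(j in [set j | (j < k)%N])
  (entry_events (S j) `|` entry_events (B j) `|` entry_events (shat j)).
(* Same points as [Omega], with the history as sigma-algebra; the measurability lemmas are rerun on
   it. *)
pose H := g_sigma_algebraType G.
have mH j : (j < k)%N -> [/\ random_matrix (S j : H -> _),
    random_matrix (B j : H -> _) & random_matrix (shat j : H -> _)].
  move=> jk; split=> a b _ Y mY; rewrite setTI; apply: sub_sigma_algebra;
    exists j => //.
  - by left; left; exists a, b, Y.
  - by left; right; exists a, b, Y.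
  - by right; exists a, b, Y.
have mxH j : (j <= k)%N -> random_matrix (x j : H -> _).
  apply: (@iterates_measurable R _ H l d f gamma1 gamma2 theta alpha_max Bmax C7 x0
    S B shat x alpha k hf x0E mH) => j' w jk.
  by apply: hst; exact: ltn_trans kN.
have subH : (@measurable _ H) `<=` (@measurable _ Omega).
  apply: smallest_sub; first exact: sigma_algebra_measurable.
  move=> A [j /= jk]; have jN := ltn_trans jk kN.
  move=> [[|]|] [a [b [Y [mY ->]]]]; rewrite -[X in measurable X]setTI.
  - by have [mS _] := hS j jN; exact: mS.
  - exact: hB.
  - exact: hs.
set A := count_events T k @^-1` [set i].
have mAH : @measurable _ H A.
  apply: (measurable_count_events (Omega := H)) => j jk.
  have [mSj _ _] := mH j jk.
  exact: (measurable_true_iteration epsS cg mSj (mxH j (ltnW jk))).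
pose Z w : option (seq_sub (hashing_matrices R l d)) := insub (S k w).
pose good (M : seq_sub (hashing_matrices R l d)) : set Omega :=
  [set w | (1 - epsS) * norm2 (gradient f (x k w)) ^+ 2
       <= norm2 (val M *m gradient f (x k w)) ^+ 2].
have mgood M : @measurable _ H (good M).
  exact: (measurable_embedded epsS cg (random_matrix_cst (val M)) (mxH k (leqnn k))).
have ZE M : Z @^-1` [set Some M] = S k @^-1` [set val M].
  apply/seteqP; split => w /=; rewrite /Z; first by case: insubP => // M' _ <- [->].
  by move=> ->; rewrite valK.
have [mS Slaw] := hS k kN.
have -> : A `&` T k = A `&` [set w | if Z w is Some M then good M w else False].
  congr (_ `&` _); apply/seteqP; split => w; rewrite /T /true_iteration /= /Z.
    by move=> [SM SP]; case: insubP => [M _ E|/negP//]; rewrite /good /= E.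
  by case: insubP => // M SM E; rewrite /good /= E.
apply: independent_choice_lower_bound.
- exact: subH.
- by move=> M; exact: subH.
- by move=> M; rewrite ZE; exact: measurable_matrix_eq.
- move=> M; rewrite ZE; apply: (hind k kN); first exact: (measurableI _ _ mAH (mgood M)).
  apply: (@measurable_matrix_eq _ _ (g_sigma_algebraType (entry_events (S k)))).
  move=> a b _ Y mY; rewrite setTI; apply: sub_sigma_algebra.
  by exists a, b, Y.
move=> w; pose E := fun M : 'M[R]_(l, d) =>
  (1 - epsS) * norm2 (gradient f (x k w)) ^+ 2 <= norm2 (M *m gradient f (x k w)) ^+ 2.
have := hembed l epsS l0 ld heps hdel (gradient f (x k w)) (ex_intro2 _ _ (x k w) I erefl).
rewrite -/E stable_hashing_prob_sum; move/le_trans; apply.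
rewrite le_eqVlt; apply/orP; left; apply/eqP; apply: eq_big => [M|M _].
  by rewrite /good /= asboolb.
by rewrite ZE Slaw.
Qed.

Theorem theorem4p5p5 (R : realType) (disp : measure_display)
  (Omega : measurableType disp) (P : probability Omega R)
  (l d : nat) (hl : (0 < l)%N) (hld : (l < d)%N)
  (* objective *)
  (f : 'cV[R]_d -> R) (L fstar : R)
  (hf : continuously_differentiable f)
  (hL : lipschitz_gradient f L)
  (hfstar : is_global_min f fstar)
  (* constant of the embedding result *)
  (C3 : R) (hC3 : 0 < C3) (hembed : hashing_embedding_constant f C3)
  (* parameters of the algorithm *)
  (gamma1 gamma2 theta alpha_max Bmax C7 alpha0 : R) (c p : nat) (x0 : 'cV[R]_d)
  (hgamma1 : 0 < gamma1 < 1) (hc : (0 < c)%N) (hgamma2 : gamma2 = gamma1 ^- c)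
  (htheta : 0 < theta < 1) (halpha_max : 0 < alpha_max) (hBmax : 0 < Bmax)
  (hC7 : 0 < C7) (hp : (0 < p)%N) (halpha0 : alpha0 = alpha_max * gamma1 ^+ p)
  (* accuracy and probability parameters *)
  (eps delta1 epsS deltaS : R)
  (heps : 0 < eps) (hdelta1 : 0 < delta1) (hepsS : 0 < epsS < 3 / 4)
  (hdeltaS : deltaS = deltaS_of C3 l epsS)
  (hdeltaS_lt : deltaS < c%:R / (c%:R + 1) ^+ 2)
  (hpos : 0 < ((1 - deltaS) * (1 - delta1) - 1 + c%:R / (c%:R + 1) ^+ 2)^-1)
  (* number of iterations *)
  (N : nat)
  (hN : N%:R >=
    ((1 - deltaS) * (1 - delta1) - 1 + c%:R / (c%:R + 1) ^+ 2)^-1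
    * ((f x0 - fstar)
         / h_value l d c gamma1 gamma2 theta Bmax C7 L eps epsS alpha0
       + (tau_alpha l d gamma1 gamma2 theta Bmax C7 L eps epsS alpha0)%:~R
         / (1 + c%:R)))
  (* the run *)
  (S : nat -> Omega -> 'M[R]_(l, d)) (B : nat -> Omega -> 'M[R]_d)
  (shat : nat -> Omega -> 'cV[R]_l)
  (x : nat -> Omega -> 'cV[R]_d) (alpha : nat -> Omega -> R)
  (hrun : random_subspace_trust_region P f (@stable_hashing R disp Omega P l d)
            gamma1 gamma2 theta alpha_max Bmax C7 x0 alpha0 N S B shat x alpha) :
  (P [set w | (N_eps f eps x w <= N%:R%:E)%E]
   >= (1 - expR (- (delta1 ^+ 2 / 2 * (1 - deltaS) * N%:R)))%:E)%E.

Proof.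
have [x0E al0E hS _ hB hs hst] := hrun; have [df cg] := hf.
have [[xm fxm] fmin] := hfstar.
have mxk : forall k, (k <= N)%N -> random_matrix (x k).
  apply: (iterates_measurable hf x0E _ hst) => k kN.
  by split; [have [] := hS k kN|exact: hB|exact: hs].
pose T := true_iteration f epsS S x.
have mT k : (k < N)%N -> measurable (T k).
  move=> kN; apply: measurable_true_iteration => //; last exact/mxk/ltnW.
  by have [] := hS k kN.
set c' : R := c%:R; rewrite -/c' in hdeltaS_lt hpos hN *.
have c'1 : 1 <= c' by rewrite ler1n.
have c1 : 0 < c' + 1 by lra.
(* By the arithmetic-geometric mean inequality; this places [deltaS] below the threshold [1 / 2] of
   the embedding result. *)
have cq : c' / (c' + 1) ^+ 2 <= 1 / 4.
  by rewrite ler_pdivrMr ?exprn_gt0 //; have := sqr_ge0 (c' - 1); lra.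
have dS0 : 0 < deltaS by rewrite hdeltaS expR_gt0.
have dS4 : deltaS < 1 / 4 by apply: lt_le_trans cq.
(* Otherwise [(1 - deltaS) (1 - delta1) <= 0], and the positive bracket would be at most
   [-3 / 4]. *)
have hd1 : delta1 < 1.
  by move: hpos; rewrite invr_gt0 => hpos'; nra.
have dS1 : 0 < deltaS_of C3 l epsS < 1 / 2 by rewrite -hdeltaS dS0; lra.
pose hit := \bigcup_(k in [set k | (k <= N)%N]) [set w | norm2 (gradient f (x k w)) <= eps].
have hitE : [set w | (N_eps f eps x w <= N%:R%:E)%E] = hit.
  apply/seteqP; split => w /=; last first.
    move=> [k /= kN gk]; apply: (@le_trans _ _ (k%:R)%:E).
      by apply: ereal_inf_lbound; exists k.
    by rewrite lee_fin ler_nat.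
  (* Without a hit up to [N], every index in the infimum is at least [N + 1]; this also covers the
     empty set, whose infimum is [+oo]. *)
  move=> Nw; apply: contrapT => nhit; move: Nw; apply/negP; rewrite -ltNge.
  apply: (@lt_le_trans _ _ (N.+1%:R)%:E); first by rewrite lte_fin ltr_nat.
  apply: le_ereal_inf_tmp => _ [k /= gk <-]; rewrite lee_fin ler_nat ltnNge.
  by apply/negP => kN; apply: nhit; exists k.
have mhit : measurable hit.
  apply: bigcup_measurable => k /= kN.
  rewrite (_ : mkset _ = setT `&` [set w | dot (gradient f (x k w)) (gradient f (x k w))
      <= eps ^+ 2]); last first.
    rewrite setTI; apply/funext => w /=.
    by rewrite -norm2_sqr ler_sqr ?nnegrE ?norm2_ge0 ?(ltW heps).
  have mg := random_matrix_gradient cg (mxk k kN).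
  by apply: measurable_fun_le => //; exact: measurable_dot.
pose bad := [set w | (count_events T N w)%:R <= (1 - delta1) * ((1 - deltaS) * N%:R)].
have mbad : measurable bad.
  rewrite (_ : bad = \bigcup_(j in [set j : nat | j%:R <= (1 - delta1) * ((1 - deltaS) * N%:R)])
      count_events T N @^-1` [set j]).
    by apply: bigcup_measurable => j _; apply: measurable_count_events.
  apply/seteqP; split => w /=; first by move=> bw; exists (count_events T N w).
  by move=> [j /= jb cj]; rewrite /bad /= cj.
have chern : fine (P bad) <= expR (- (delta1 ^+ 2 / 2 * (1 - deltaS) * N%:R)).
  apply: chernoff_lower_tail => //; [lra|lra|] => k i kN.
  rewrite hdeltaS; exact: (true_iteration_given_history _ hl hld hf hembed hepsS dS1 hrun kN).
have sub : ~` hit `<=` bad.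
  move=> w nhit; rewrite /bad /=.
  have geps k : (k < N)%N -> eps < norm2 (gradient f (x k w)).
    by move=> kN; rewrite ltNge; apply/negP => gk; apply: nhit; exists k => //=; exact: ltnW.
  have epsS1 : epsS < 1 by lra.
  have := trust_region_true_count (good := fun k => `[< T k w >]) (S := S ^~ w)
    (B := B ^~ w) (shat := shat ^~ w) (x := x ^~ w) (alpha := alpha ^~ w)
    hl hld df hL fmin hgamma1 hc hgamma2 htheta halpha_max hBmax hC7 halpha0 heps epsS1
    (x0E w) (al0E w) (fun k kN => hst k w kN) geps (fun k Tk => asboolW Tk).
  rewrite -/(count_events T N w) -/c'.
  move: hN; rewrite ler_pdivrMl; last by rewrite -invr_gt0.
  set q1 := (_ - _) / _; set q2 := _ / (1 + c'); set n1 := _%:R => hN1 Hc.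
  (* The condition on [N] bounds the two constant terms by the bracket times [N]. Adding
     [c / (c + 1) * N] and using this inequality leaves at most [(1 - deltaS) (1 - delta1) N] true
     iterations, so the sample point is in [bad]. *)
  have : c' / (c' + 1) ^+ 2 + c' / (c' + 1) <= 1.
    have -> : c' / (c' + 1) = (c' * (c' + 1)) / (c' + 1) ^+ 2.
      by field; rewrite gt_eqF.
    by rewrite -mulrDl ler_pdivrMr ?exprn_gt0 //; lra.
  have N0 : 0 <= N%:R :> R by [].
  move=> /(ler_wpM2r N0); lra.
rewrite hitE -[hit]setCK probability_setC; last exact: measurableC.
rewrite EFinB leeB // -[P _]fineK ?fin_num_measure //; last exact: measurableC.
rewrite lee_fin; apply: le_trans chern; apply: fine_le; rewrite ?fin_num_measure //.
  exact: measurableC.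
by apply: le_measure; rewrite ?inE //; exact: measurableC.
Qed.
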